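(* Let $f>0$, $\kappa>0$, $r\ge 0$, and let $\|\cdot\|$ be the Euclidean norm on $\mathbb{R}^2$. Let $\alpha^*(\infty,r)$ be the root in $[0,\pi/2)$ of $\lim_{n\to\infty}(n-2)H(n,r,\alpha)=0$ and let $g(\infty,r)=\lim_{n\to\infty}g(n,r)$ (with $H$ and $g$ as in the context). Then the optimal value $z$ of the transshipment facility layout problem satisfies $$z\ \ge\ 3\sqrt[3]{\frac{\kappa^2 f^3}{4\,g^2(\infty,r)}} .$$
   Context: Problem. A design consists of: (i) a locally finite infinite set $X\subset\mathbb{R}^2$ of facility locations; (ii) service regions $\mathcal{A}(p)$, $p\in X$, which are measurable sets of finite positive area, cover $\mathbb{R}^2$, overlap pairwise only in null sets, and satisfy $\|x-p\|\le\|x-q\|$ for all $x\in\mathcal{A}(p)$ and $q\in X$ (Voronoi diagram, ties broken arbitrarily); (iii) for each $N\ge 1$ a closed inbound truck tour $x_1,x_2,\dots,x_N,x_1$ through $N$ distinct facilities of $X$ (the choice may depend on $N$; indices are taken modulo $N$), such that, with $\mathcal{A}_i=\mathcal{A}(x_i)$ and $A_i=|\mathcal{A}_i|$, the sets $U_N=\bigcup_{i=1}^N\mathcal{A}_i$ exhaust the plane: there are $\rho_N\to\infty$ such that, for all large $N$, $B(0,\rho_N)\subset U_N$ up to a null set, and $|U_N\setminus B(0,\rho_N)|/|U_N|\to0$. The truck's travel distance attributed to facility $i$ is $l_i=\frac12(\|x_i-x_{i-1}\|+\|x_i-x_{i+1}\|)$. The cost of the design is $$\liminf_{N\to\infty}\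 \left[\frac{f}{\sum_{i=1}^N A_i}\sum_{i=1}^N\Bigl(1+\kappa\int_{\mathcal{A}_i}\|x-x_i\|\,dx\Bigr)+\frac{\kappa r f}{N}\sum_{i=1}^N l_i\right],$$ and $z$ is the infimum of the cost over all designs. Functions. For real $n\ge3$, $\alpha\in[\pi/n,\pi/2)$, put $\bar\alpha=\frac{\pi-2\alpha}{n-2}$ and $$H(n,r,\alpha)=\sin\alpha\cos^2\bar\alpha\,\log\tan\Bigl(\frac{\pi}{4}+\frac{\bar\alpha}{2}\Bigr)-\cos^2\alpha\,\sin\bar\alpha\,\log\tan\Bigl(\frac{\pi}{4}+\frac{\alpha}{2}\Bigr)-r\sin 2\alpha\,\sin\bar\alpha-r(n-2)\cos\bar\alpha\,\sin^2\bar\alpha$$ (the same formula is used for all $\alpha\in[0,\pi/2)$ when taking the limit $n\to\infty$). $\alpha^*(n,r)$ denotes the unique root of $H(n,r,\alpha)=0$ in $[\pi/n,\pi/2)$, and, with $\alpha=\alpha^*(n,r)$ and $\bar\alpha=\frac{\pi-2\alpha}{n-2}$, $$g(n,r)=\frac{3\sin\bar\alpha\,\bigl(\sin 2\alpha+(n-2)\cos\bar\alpha\sin\bar\alpha\bigr)^{1/2}}{\sin\bar\alpha+\cos^2\bar\alpha\,\log\tan\bigl(\frac{\pi}{4}+\frac{\bar\alpha}{2}\bigr)+4r\sin\bar\alpha\cos\alpha}.$$ *)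

(* Defs.v *)
(* MathComp-Analysis, over an arbitrary [R : realType]; the plane is [R * R]. *)
From HB Require Import structures.
From mathcomp Require Import all_boot all_order all_algebra.
From mathcomp Require Import all_classical all_reals all_analysis.

Set Implicit Arguments.
Unset Strict Implicit.
Unset Printing Implicit Defensive.

Import Order.TTheory GRing.Theory Num.Theory.
Import numFieldNormedType.Exports.

Local Open Scope classical_set_scope.
Local Open Scope ring_scope.

(* The library norm on [R * R] is the max norm, hence explicit definitions. *)
Definition enorm (R : realType) (x : R * R) : R :=
  Num.sqrt (x.1 ^+ 2 + x.2 ^+ 2).

Definition euclid_dist (R : realType) (x y : R * R) : R := enorm (x - y).

Definition disc (R : realType) (rho : R) : set (R * R) :=
  [set x | enorm x < rho].

(* Lebesgue measure on Borel sets of the plane. *)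
Definition borel_area (R : realType) :
    set (measurableTypeR R * measurableTypeR R) -> \bar R :=
  (@lebesgue_measure R \x @lebesgue_measure R)%E.
HB.instance Definition _ (R : realType) := Measure.on (@borel_area R).

(* Complete Lebesgue measure on the plane, obtained from [borel_area] exactly as
   [completed_lebesgue_measure] is obtained on the line; its domain is a copy of
   [R * R] carrying the sigma-algebra of all Lebesgue measurable sets. *)
Definition area (R : realType) : set _ -> \bar R :=
  @completed_measure_extension _ _ _ (@borel_area R).
HB.instance Definition _ (R : realType) := Measure.on (@area R).

Definition lebesgue_measurable (R : realType) (A : set (R * R)) : Prop :=
  ((@borel_area R)^*)%mu.-cara.-measurable A.

(* [region p] is only meaningful for [p] in [facilities].  [tour N i] is the
   [i]-th facility, counted from 0, of the tour through [N] facilities. *)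
Record design (R : realType) := Design {
  facilities : set (R * R);
  region : R * R -> set (R * R);
  tour : forall N : nat, 'I_N -> R * R;
  facilities_infinite : infinite_set facilities;
  facilities_locally_finite :
    forall rho : R, finite_set (facilities `&` disc rho);
  region_measurable :
    forall p, facilities p -> lebesgue_measurable (region p);
  region_area :
    forall p, facilities p -> (0 < area (region p) < +oo)%E;
  region_cover : \bigcup_(p in facilities) region p = [set: R * R];
  region_overlap : forall p q, facilities p -> facilities q -> p <> q ->
    area (region p `&` region q) = 0%E;
  region_nearest : forall p q x, facilities p -> facilities q -> region p x ->
    euclid_dist x p <= euclid_dist x q;
  tour_facilities : forall N (i : 'I_N), facilities (tour i);
  tour_distinct : forall N, injective (@tour N);
  tour_exhausts : exists rho : nat -> R,
    let U N := \bigcup_(i in [set: 'I_N]) region (tour i) in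
    [/\ rho @ \oo --> +oo,
        \forall N \near \oo, area (disc (rho N) `\` U N) = 0%E
      & (fun N => fine (area (U N `\` disc (rho N))) / fine (area (U N)))
          @ \oo --> (0 : R)]
}.

Section Cost.
Variables (R : realType) (f kappa r : R) (D : design R).

(* [ord_pred] and [ordS] are the cyclic predecessor and successor on ['I_N]. *)
Definition truck_distance (N : nat) (i : 'I_N) : R :=
  2^-1 * (euclid_dist (tour D i) (tour D (ord_pred i)) +
          euclid_dist (tour D i) (tour D (ordS i))).

(* The integrals may be infinite, so costs live in the extended reals. *)
Definition average_cost (N : nat) : \bar R :=
  ((f / \sum_(i < N) fine (area (region D (tour D i))))%:E *
     (\sum_(i < N) (1 + kappa%:E *
        \int[@area R]_(x in region D (tour D i))
          (euclid_dist x (tour D i))%:E)) +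
   (kappa * r * f / N%:R * \sum_(i < N) truck_distance i)%:E)%E.

Definition cost : \bar R := limn_einf average_cost.

End Cost.

Definition optimal_value (R : realType) (f kappa r : R) : \bar R :=
  ereal_inf (range (@cost R f kappa r)).

Section Bound.
Variable R : realType.
Implicit Types n r alpha : R.

Definition alpha_bar n alpha : R := (pi - 2 * alpha) / (n - 2).

Definition log_tan (x : R) : R := ln (tan (pi / 4 + x / 2)).

Definition H n r alpha : R :=
  let abar := alpha_bar n alpha in
  sin alpha * cos abar ^+ 2 * log_tan abar
  - cos alpha ^+ 2 * sin abar * log_tan alpha
  - r * sin (2 * alpha) * sin abar
  - r * (n - 2) * cos abar * sin abar ^+ 2.

Definition alpha_star n r : R :=
  get [set alpha | pi / n <= alpha < pi / 2 /\ H n r alpha = 0].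

Definition g n r : R :=
  let alpha := alpha_star n r in
  let abar := alpha_bar n alpha in
  3 * sin abar *
    Num.sqrt (sin (2 * alpha) + (n - 2) * cos abar * sin abar) /
  (sin abar + cos abar ^+ 2 * log_tan abar + 4 * r * sin abar * cos alpha).

Definition alpha_star_infty r : R :=
  get [set alpha | 0 <= alpha < pi / 2 /\
    ((n - 2) * H n r alpha) @[n --> +oo] --> (0 : R)].

Definition g_infty r : R := lim (g n r @[n --> +oo]).

End Bound.

(* Main.v *)
From HB Require Import structures.
Require Import Defs.
From mathcomp Require Import all_boot all_order all_algebra.
From mathcomp Require Import all_classical all_reals all_analysis.
From mathcomp Require Import measurable_realfun ring lra.

Import Order.TTheory GRing.Theory Num.Theory.
Import numFieldNormedType.Exports.

Local Open Scope ring_scope.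
Local Open Scope classical_set_scope.

Set Implicit Arguments.
Unset Strict Implicit.
Unset Printing Implicit Defensive.

(** Fix a radius [rho] and call cone over [p] the function
    [max 0 (rho - |x - p|)].  On the region of the stop [x_i] the distance to
    [x_i] is at least [rho] minus the cone over [x_i].  Hence, if [G] dominates
    the cones over all the stops, the total access cost of the tour is at least
    [rho] times the area served, minus the integral of [G], because regions
    that overlap in null sets charge [G] only once
    ([covering_integral_bound]).

    Along the tour one can take for [G] the cone over the first stop plus the
    positive parts of the differences of consecutive cones
    ([telescoped_cone]).  The integral of such a positive part is the gain of a
    leg: it depends only on the length [d] of the leg, and it equals the
    integral of one cone over the strip of width [d] around its apex, because
    two equal cones cross on the perpendicular bisector of their apexes.  So
    the bound adds up over the legs, whatever the angles between them.

    As a function of [d] the gain is concave, its slope being the integral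
    [chord] of the cone along the line at distance [d / 2] from the apex.
    It is bounded by its tangent line at any [d = 2 * a]
    ([integral_cone_gain]).  For [a = rho * cos alpha] the slope is
    [rho^2 (sin alpha - cos^2 alpha * L)] with [L = log_tan alpha].  Choose
    [alpha] with [sin alpha - cos^2 alpha * L = r S], where
    [S = sin (2 alpha) + pi - 2 alpha], and [rho] with [rho^2 S] equal to the
    mean area [A] of the regions: the slope is then [r A], exactly the price of
    one unit of travel, and the lengths of the legs disappear.  Up to a term of
    order [1 / N] there remains [f / A + kappa f sqrt A / g] with
    [g = 3 sqrt S / (2 (1 + 2 r cos alpha))], and the inequality of means gives
    the bound ([average_cost_ge], [cost_ge]).

    It remains to recognize [g_infty r] ([g_inftyE]).  Divided by [alpha_bar],
    the function [H n r] converges, uniformly in [alpha], to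
    [sin alpha - cos^2 alpha * L - r S], which is strictly increasing; so the
    roots [alpha_star n r] converge to the angle [alpha] above, and [g n r]
    converges to that value of [g]. *)

(** * Differentiation rules and the fundamental theorem of calculus *)

Section calculus.
Variable R : realType.
Implicit Types (f F g : R -> R) (x a b : R).

(** The differentiation rules in pointwise form, to be composed as terms that
    follow the shape of an expression. *)
Lemma der_add f g x a b : is_derive x 1 f a -> is_derive x 1 g b ->
  is_derive x 1 (fun y => f y + g y) (a + b).
Proof. exact: is_deriveD. Qed.
Lemma der_sub f g x a b : is_derive x 1 f a -> is_derive x 1 g b ->
  is_derive x 1 (fun y => f y - g y) (a - b).
Proof. exact: is_deriveB. Qed.
Lemma der_mul f g x a b : is_derive x 1 f a -> is_derive x 1 g b ->
  is_derive x 1 (fun y => f y * g y) (f x * b + g x * a).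
Proof. exact: is_deriveM. Qed.
Lemma der_cst x c : is_derive x 1 (fun=> c : R) 0.
Proof. exact: is_derive_cst. Qed.
Lemma der_id x : is_derive x 1 (fun y : R => y) 1.
Proof. exact: is_derive_id. Qed.
Lemma der_comp f g x a b : is_derive (g x) 1 f a -> is_derive x 1 g b ->
  is_derive x 1 (fun y => f (g y)) (a * b).
Proof. exact: (@is_derive1_comp R f g). Qed.
Lemma der_inv f x a : f x != 0 -> is_derive x 1 f a ->
  is_derive x 1 (fun y => (f y)^-1) (- (f x) ^- 2 * a).
Proof. exact: is_deriveV. Qed.
Lemma der_sqrt f x a : 0 < f x -> is_derive x 1 f a ->
  is_derive x 1 (fun y => Num.sqrt (f y)) ((2 * Num.sqrt (f x))^-1 * a).
Proof. by move=> fx df; apply: (@der_comp Num.sqrt f) => //; exact: is_derive1_sqrt. Qed.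
Lemma der_ln f x a : 0 < f x -> is_derive x 1 f a ->
  is_derive x 1 (fun y => ln (f y)) ((f x)^-1 * a).
Proof. by move=> fx df; apply: (@der_comp (@ln R) f) => //; exact: is_derive1_ln. Qed.
Lemma der_atan f x a : is_derive x 1 f a ->
  is_derive x 1 (fun y => atan (f y)) ((1 + f x ^+ 2)^-1 * a).
Proof. by move=> df; apply: (@der_comp (@atan R) f). Qed.
Lemma der_eq f x a b : is_derive x 1 f a -> a = b -> is_derive x 1 f b.
Proof. by move=> ? <-. Qed.

Lemma is_derive_continuous f x a : is_derive x 1 f a -> {for x, continuous f}.
Proof.
move=> [df _]; apply: differentiable_continuous.
exact/derivable1_diffP.
Qed.

Lemma integral_FTC2 f F a b : a < b ->
  {in `[a, b]%R, forall x, {for x, continuous f}} ->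
  {in `[a, b]%R, forall x, {for x, continuous F}} ->
  {in `]a, b[%R, forall x, is_derive x 1 F (f x)} ->
  (\int[@lebesgue_measure R]_(x in `[a, b]) (f x)%:E = (F b - F a)%:E)%E.
Proof.
move=> ab cf cF dF; rewrite EFinB; apply: continuous_FTC2 => //.
- apply: continuous_in_subspaceT => x /[!(@mem_setE R)] xab; exact: cf.
- split.
  + by move=> x /dF [].
  + by apply: cvg_at_right_filter; apply: cF; rewrite in_itv/= lexx ltW.
  + by apply: cvg_at_left_filter; apply: cF; rewrite in_itv/= lexx ltW.
- by move=> x /dF [_ dx]; rewrite derive1E.
Qed.
End calculus.

(** * Translations, shears and rotations of the plane *)

Section plane_isometries.
Local Open Scope ereal_scope.
Variable R : realType.
Notation leb := (@lebesgue_measure R).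

Lemma lebesgue_measure_translation (a : R) (A : set (measurableTypeR R)) :
  measurable A ->
  pushforward leb (fun x : measurableTypeR R => (x + a)%R : measurableTypeR R) A = leb A.
Proof.
pose tr := (fun x : measurableTypeR R => (x + a)%R : measurableTypeR R).
have mtr : measurable_fun setT tr.
  by apply: measurable_funD => //; exact: measurable_cst.
pose trM : {mfun measurableTypeR R >-> measurableTypeR R} :=
  HB.pack tr (isMeasurableFun.Build _ _ _ _ tr mtr).
move=> mA; apply/esym.
apply: (@lebesgue_measure_unique R (pushforward leb trM)) => // X [[b c] _ <-] /=.
rewrite lebesgue_measure_itv/= /pushforward.
have -> : trM @^-1` `]b, c] = `](b - a)%R, (c - a)%R]%classic.
  by apply/seteqP; split=> x /=; rewrite !in_itv/= /tr => /andP[h1 h2]; apply/andP; split; lra.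
rewrite lebesgue_measure_itv/= !lte_fin.
have -> : (b - a < c - a)%R = (b < c)%R by apply/idP/idP; lra.
by case: ifP => // _; rewrite -!EFinB; congr (_%:E); lra.
Qed.

(** Both the translations and the reflection of the line are obtained from
    this one. *)
Lemma integral_preserving (phi : R -> R) (f : R -> \bar R) :
  measurable_fun setT phi ->
  (forall A : set (measurableTypeR R), measurable A -> leb (phi @^-1` A) = leb A) ->
  measurable_fun setT f -> (forall x, 0 <= f x) ->
  \int[leb]_x f (phi x) = \int[leb]_x f x.
Proof.
move=> mphi lphi mf f0.
have mp : measurable_fun setT (phi : measurableTypeR R -> measurableTypeR R) by [].
pose phiM : {mfun measurableTypeR R >-> measurableTypeR R} :=
  HB.pack (phi : measurableTypeR R -> measurableTypeR R)
    (isMeasurableFun.Build _ _ _ _ _ mp).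
transitivity (\int[pushforward leb phiM]_x f x).
  by rewrite (@ge0_integral_pushforward _ _ _ _ _ _ mp leb setT).
by apply: eq_measure_integral => A mA _; exact: lphi.
Qed.

Lemma integral_translation (a : R) (f : R -> \bar R) :
  measurable_fun setT f -> (forall x, 0 <= f x) ->
  \int[leb]_x f (x + a)%R = \int[leb]_x f x.
Proof.
apply: (@integral_preserving (fun x => x + a)%R).
  by apply: measurable_funD => //; exact: measurable_cst.
exact: lebesgue_measure_translation.
Qed.

Lemma integral_reflect (f : R -> \bar R) :
  measurable_fun setT f -> (forall x, 0 <= f x) ->
  \int[leb]_x f (- x)%R = \int[leb]_x f x.
Proof.
apply: (@integral_preserving (fun x => - x)%R); first exact: oppr_measurable.
exact: lebesgue_measureN.
Qed.

Notation P := (measurableTypeR R * measurableTypeR R)%type.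
Lemma integral_borel_area1 (f : P -> \bar R) :
  measurable_fun setT f -> (forall x, 0 <= f x) ->
  \int[@borel_area R]_x f x = \int[leb]_x \int[leb]_y f (x, y).
Proof. by move=> mf f0; exact: (@fubini_tonelli1 _ _ _ _ _ leb leb f mf f0). Qed.

Lemma integral_borel_area2 (f : P -> \bar R) :
  measurable_fun setT f -> (forall x, 0 <= f x) ->
  \int[@borel_area R]_x f x = \int[leb]_y \int[leb]_x f (x, y).
Proof. by move=> mf f0; exact: (@fubini_tonelli2 _ _ _ _ _ leb leb f mf f0). Qed.

(** On every horizontal line a horizontal shear is a translation. *)
Lemma integral_shear1 (t : R -> R) (f : P -> \bar R) :
  measurable_fun setT t ->
  measurable_fun setT f -> (forall x, 0 <= f x) ->
  \int[@borel_area R]_x f (x.1 + t x.2, x.2)%R = \int[@borel_area R]_x f x.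
Proof.
move=> mt mf f0.
have mf' : measurable_fun setT (fun x : P => f (x.1 + t x.2, x.2)%R).
  apply: (measurableT_comp mf); apply: measurable_fun_pair => //=.
  by apply: measurable_funD => //; exact: measurableT_comp.
rewrite (integral_borel_area2 mf' (fun=> f0 _)) (integral_borel_area2 mf f0).
apply: eq_integral => y _; rewrite /=.
apply: (@integral_translation (t y) (fun x => f (x, y))) => //.
by apply: (measurableT_comp mf); exact: measurable_pair2.
Qed.

Lemma integral_shear2 (t : R -> R) (f : P -> \bar R) :
  measurable_fun setT t ->
  measurable_fun setT f -> (forall x, 0 <= f x) ->
  \int[@borel_area R]_x f (x.1, x.2 + t x.1)%R = \int[@borel_area R]_x f x.
Proof.
move=> mt mf f0.
have mf' : measurable_fun setT (fun x : P => f (x.1, x.2 + t x.1)%R).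
  apply: (measurableT_comp mf); apply: measurable_fun_pair => //=.
  by apply: measurable_funD => //; exact: measurableT_comp.
rewrite (integral_borel_area1 mf' (fun=> f0 _)) (integral_borel_area1 mf f0).
apply: eq_integral => x _; rewrite /=.
apply: (@integral_translation (t x) (fun y => f (x, y))) => //.
by apply: (measurableT_comp mf); exact: measurable_pair1.
Qed.

Lemma integral_translation2 (p : R * R) (f : R * R -> \bar R) :
  measurable_fun setT (f : P -> _) -> (forall x, 0 <= f x) ->
  \int[@borel_area R]_x f (x - p)%R = \int[@borel_area R]_x f x.
Proof.
move=> mf f0.
rewrite -[RHS](@integral_shear2 (fun=> - p.2)%R f)//.
rewrite -[RHS](@integral_shear1 (fun=> - p.1)%R (fun x => f (x.1, x.2 - p.2)%R))//.
apply: (measurableT_comp mf); apply: measurable_fun_pair => //=.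
by apply: measurable_funD => //; exact: measurableT_comp.
Qed.

Lemma measurable_linear2 (a b c d : R) :
  measurable_fun setT (fun x : P => (a * x.1 + b * x.2, c * x.1 + d * x.2)%R : P).
Proof.
by apply: measurable_fun_pair => /=;
  apply: measurable_funD; apply: measurable_funM => //.
Qed.

(** A rotation of angle [theta] other than the half-turn is a product of three
    shears, of coefficients [- tan (theta / 2)], [sin theta] and
    [- tan (theta / 2)]. *)
Lemma integral_rotation_not_half_turn (c s : R) (f : R * R -> \bar R) :
  (c ^+ 2 + s ^+ 2 = 1)%R -> (c != -1)%R ->
  measurable_fun setT (f : P -> _) -> (forall x, 0 <= f x) ->
  \int[@borel_area R]_x f (c * x.1 - s * x.2, s * x.1 + c * x.2)%R =
  \int[@borel_area R]_x f x.
Proof.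
move=> cs c1 mf f0.
have c1' : (1 + c != 0)%R by apply: contra_neq c1 => ?; lra.
pose t := (s / (1 + c))%R.
have tc : (t * (1 + c) = s)%R by rewrite /t divfK.
have ts : (t * s = 1 - c)%R.
  apply: (mulIf c1'); rewrite mulrAC tc; nra.
pose A1 (x : P) : P := (x.1 + (- t) * x.2, x.2)%R.
pose A2 (x : P) : P := (x.1, x.2 + s * x.1)%R.
have mA1 : measurable_fun setT A1.
  apply: measurable_fun_pair => //=.
  by apply: measurable_funD => //; apply: measurable_funM.
have mA2 : measurable_fun setT A2.
  apply: measurable_fun_pair => //=.
  by apply: measurable_funD => //; apply: measurable_funM.
have ml (k : R) : measurable_fun setT (fun y : R => k * y)%R.
  exact: measurable_funM.
have mf1 : measurable_fun setT (f \o A1 : P -> _) := measurableT_comp mf mA1.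
have mf2 : measurable_fun setT (f \o A1 \o A2 : P -> _) := measurableT_comp mf1 mA2.
rewrite -[RHS](integral_shear1 (ml (- t)%R) mf f0).
rewrite -[RHS](integral_shear2 (ml s) mf1 (fun=> f0 _)).
rewrite -[RHS](integral_shear1 (ml (- t)%R) mf2 (fun=> f0 _)).
apply: eq_integral => -[x y] _ /=; rewrite /A1 /A2/=; congr (f (_, _)).
  apply/eqP; rewrite -subr_eq0; apply/eqP.
  transitivity ((c * x - s * y) - ((1 - t * s) * x - (t * (1 + (1 - t * s))) * y))%R.
    by ring.
  by rewrite ts subKr tc subrr.
transitivity (s * x + (1 - t * s) * y)%R; last by ring.
by rewrite ts subKr.
Qed.

(** The half-turn is the square of the quarter turn. *)
Lemma integral_rotation (c s : R) (f : R * R -> \bar R) :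
  (c ^+ 2 + s ^+ 2 = 1)%R ->
  measurable_fun setT (f : P -> _) -> (forall x, 0 <= f x) ->
  \int[@borel_area R]_x f (c * x.1 - s * x.2, s * x.1 + c * x.2)%R =
  \int[@borel_area R]_x f x.
Proof.
move=> cs mf f0; have [c1|cn] := eqVneq c (-1)%R; last exact: (integral_rotation_not_half_turn cs cn mf f0).
have s0 : (s = 0)%R by apply/eqP; rewrite -sqrf_eq0; apply/eqP; rewrite c1 in cs; lra.
have c0 : (0%R : R) != (-1)%R by rewrite eq_sym oppr_eq0 oner_eq0.
have e1 : (0 ^+ 2 + 1 ^+ 2 = 1 :> R)%R by rewrite expr0n/= expr1n add0r.
pose J (x : P) : P := (0 * x.1 - 1 * x.2, 1 * x.1 + 0 * x.2)%R.
have mJ : measurable_fun setT J.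
  have := measurable_linear2 0 (-1) 1 0.
  by congr (measurable_fun _ _); apply/funext => x; rewrite /J; congr (_, _); ring.
have mfJ : measurable_fun setT (f \o J : P -> _) := measurableT_comp mf mJ.
rewrite -[RHS](integral_rotation_not_half_turn e1 c0 mf f0).
rewrite -[RHS](integral_rotation_not_half_turn e1 c0 mfJ (fun=> f0 _)).
by apply: eq_integral => -[x y] _ /=; rewrite /J/= c1 s0; congr (f (_, _)); ring.
Qed.
End plane_isometries.

(** * Completed area and almost disjoint regions *)

Section almost_disjoint.
Local Open Scope ereal_scope.

(** Removing the null union of the pairwise intersections makes the family
    disjoint and changes none of the integrals. *)
Lemma sum_integral_almost_disjoint d (T : measurableType d) (R : realType)
    (mu : {measure set T -> \bar R}) (I : finType) (F : I -> set T)
    (f : T -> \bar R) :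
  (forall i, measurable (F i)) ->
  (forall i j, i != j -> mu (F i `&` F j) = 0) ->
  measurable_fun setT f -> (forall x, 0 <= f x) ->
  \sum_i \int[mu]_(x in F i) f x <= \int[mu]_x f x.
Proof.
move=> mF F0 mf f0.
pose N := \big[setU/set0]_(p : I * I | p.1 != p.2) (F p.1 `&` F p.2).
have mN : measurable N.
  by apply: bigsetU_measurable => p _; exact: measurableI.
have N0 : mu N = 0.
  apply: measure_negligible => //; rewrite /N.
  elim/big_ind: _ => [|A B|[i j] /= ij]; first exact: negligible_set0.
    exact: negligibleU.
  by apply/negligibleP; [exact: measurableI|exact: F0].
have mFN i : measurable (F i `\` N) by exact: measurableD.
rewrite (eq_bigr (fun i => \int[mu]_(x in F i `\` N) f x)); last first.
  move=> i _; apply: ge0_negligible_integral => //.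
  exact: measurable_funTS.
rewrite -ge0_integral_bigsetU//.
- apply: ge0_subset_integral => //.
  by apply: bigsetU_measurable => i _.
- exact: index_enum_uniq.
- apply/trivIsetP => i j _ _ ij; rewrite -subset0 => x [[Fi nN] [Fj _]].
  by apply: nN; rewrite /N (bigD1 (i, j))//=; left.
- exact: measurable_funTS.
Qed.

(** Integrate [rho <= h i + G] over [F i] and add up: almost disjoint sets
    charge [G] at most once. *)
Lemma sum_integral_lower_bound d (T : measurableType d) (R : realType)
    (mu : {measure set T -> \bar R}) (I : finType) (F : I -> set T)
    (h : I -> T -> R) (G : T -> R) (rho : R) :
  (forall i, measurable (F i)) -> (forall i, mu (F i) < +oo) ->
  (forall i j, i != j -> mu (F i `&` F j) = 0) ->
  (forall i, measurable_fun setT (h i)) -> (forall i x, (0 <= h i x)%R) ->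
  measurable_fun setT G -> (forall x, (0 <= G x)%R) ->
  (0 <= rho)%R -> (forall i x, (rho <= h i x + G x)%R) ->
  (rho * \sum_i fine (mu (F i)))%:E <=
  \sum_i \int[mu]_(x in F i) (h i x)%:E + \int[mu]_x (G x)%:E.
Proof.
move=> mF Foo F0 mh h0 mG G0 rho0 hG.
have mGE : measurable_fun setT (EFin \o G) by exact/measurable_EFinP.
have mhE i : measurable_fun setT (EFin \o h i) by exact/measurable_EFinP.
apply: (@le_trans _ _ (\sum_i \int[mu]_(x in F i) (h i x)%:E
   + \sum_i \int[mu]_(x in F i) (G x)%:E)); last first.
  apply: leeD => //.
  by apply: sum_integral_almost_disjoint => // x; rewrite lee_fin.
rewrite -big_split/= mulr_sumr -sumEFin; apply: lee_sum => i _.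
have mhi := measurable_funS measurableT (@subsetT _ (F i)) (mhE i).
have mGi := measurable_funS measurableT (@subsetT _ (F i)) mGE.
have hi0 x : F i x -> 0 <= (h i x)%:E by move=> _; rewrite lee_fin.
have Gi0 x : F i x -> 0 <= (G x)%:E by move=> _; rewrite lee_fin.
rewrite -(ge0_integralD mu (mF i) hi0 mhi Gi0 mGi).
rewrite EFinM fineK; last by rewrite ge0_fin_numE.
rewrite -integral_cst//.
apply: ge0_le_integral => //.
- exact: emeasurable_funD.
- by move=> x _; rewrite -EFinD lee_fin.
Qed.

End almost_disjoint.

Section completed_area.
Local Open Scope ereal_scope.
Variable R : realType.
Notation P := (measurableTypeR R * measurableTypeR R)%type.

Lemma measurable_caratheodory (A : set P) :
  measurable A -> lebesgue_measurable A.
Proof. exact: caratheodory_measurable_mu_ext. Qed.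

Lemma area_borel (A : set P) : measurable A -> area A = borel_area A.
Proof. by move=> mA; rewrite /area /completed_measure_extension measurable_mu_extE. Qed.

Notation L := (caratheodory_type ((@borel_area R)^*)%mu).

Lemma measurable_fun_caratheodory d (T : measurableType d) (f : P -> T) :
  measurable_fun setT f -> measurable_fun setT (f : L -> T).
Proof.
move=> mf _ B mB; rewrite setTI; apply: measurable_caratheodory.
by rewrite -[X in measurable X]setTI; exact: mf.
Qed.

(** The identity is measurable from the completed sigma-algebra to the Borel
    one and pushes [area] forward to [borel_area].  This gives access to
    Tonelli's theorem, which concerns the product measure. *)
Lemma integral_area_borel (f : P -> \bar R) :
  measurable_fun setT f -> (forall x, 0 <= f x) ->
  \int[@area R]_x f x = \int[@borel_area R]_x f x.
Proof.
move=> mf f0.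
have mid : measurable_fun setT (idfun : L -> P).
  exact: (measurable_fun_caratheodory (@measurable_id _ P setT)).
pose idM : {mfun L >-> P} := HB.pack (idfun : L -> P) (isMeasurableFun.Build _ _ _ _ _ mid).
transitivity (\int[pushforward (@area R) idM]_x f x).
  by rewrite (@ge0_integral_pushforward _ _ _ _ _ _ mid (@area R) setT).
by apply: eq_measure_integral => A mA _; rewrite /pushforward /=; exact: area_borel.
Qed.

Lemma measurable_enorm : measurable_fun setT (@enorm R : P -> R).
Proof.
rewrite /enorm; apply: (@measurableT_comp _ _ _ _ _ _ (@Num.sqrt R)).
  by apply: continuous_measurable_fun; exact: sqrt_continuous.
by apply: measurable_funD; apply: measurable_funX.
Qed.

Lemma measurable_euclid_dist (p : R * R) :
  measurable_fun setT (fun x : P => euclid_dist x p).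
Proof.
apply: (measurableT_comp measurable_enorm).
by apply: measurable_fun_pair; apply: measurable_funB.
Qed.

Lemma covering_integral_bound (D : design R) (N : nat) (rho : R) (G : R * R -> R) :
  (0 <= rho)%R ->
  measurable_fun setT (G : P -> R) -> (forall x, 0 <= G x)%R ->
  (forall (i : 'I_N) x, (rho <= euclid_dist x (tour D i) + G x)%R) ->
  (rho * \sum_(i < N) fine (area (region D (tour D i))))%:E <=
  \sum_(i < N) \int[@area R]_(x in region D (tour D i)) (euclid_dist x (tour D i))%:E
  + \int[@borel_area R]_x (G x)%:E.
Proof.
move=> rho0 mG G0 hG.
have mGE : measurable_fun setT (EFin \o G : P -> _) by exact/measurable_EFinP.
have mR (i : 'I_N) : (measurable : set (set L)) (region D (tour D i)).
  by apply: region_measurable; exact: tour_facilities.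
rewrite -(integral_area_borel mGE); last by move=> x; rewrite lee_fin.
have Foo (i : 'I_N) : area (region D (tour D i)) < +oo.
  by have /andP[] := region_area (tour_facilities D i).
have F0 (i j : 'I_N) : i != j ->
    area (region D (tour D i) `&` region D (tour D j)) = 0.
  move=> ij; apply: region_overlap; [exact: tour_facilities|exact: tour_facilities|].
  by move=> /(@tour_distinct _ D N) /eqP; rewrite (negbTE ij).
have mh (i : 'I_N) := measurable_fun_caratheodory (measurable_euclid_dist (tour D i)).
have h0 (i : 'I_N) x : (0 <= euclid_dist x (tour D i))%R by exact: sqrtr_ge0.
have mG' := measurable_fun_caratheodory mG.
exact (@sum_integral_lower_bound _ L R (@area R) 'I_N (fun i => region D (tour D i))
  (fun i x => euclid_dist x (tour D i)) G rho mR Foo F0 mh h0 mG' G0 rho0 hG).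
Qed.
End completed_area.

(** * Integral of a cone along a line *)

Section chord.
Variable R : realType.
Notation leb := (@lebesgue_measure R).
Variable rho : R.
Hypothesis rho0 : 0 < rho.
Implicit Types u y : R.

(** Integral of the cone of height and radius [rho] along a line at distance
    [`|u|] from its apex. *)
Definition chord u : \bar R :=
  (\int[leb]_y (Num.max 0 (rho - Num.sqrt (u ^+ 2 + y ^+ 2)))%:E)%E.

Definition half_chord u : R := Num.sqrt (rho ^+ 2 - u ^+ 2).

(** Closed form of [chord] for [0 < u <= rho].  The two logarithms make up the
    inverse hyperbolic cosine of [rho / u]. *)
Definition chord_value u : R :=
  let w := half_chord u in rho * w - u ^+ 2 * (ln (rho + w) - ln u).

Lemma le_sqr (a b : R) : 0 <= a -> 0 <= b -> (a <= b) = (a ^+ 2 <= b ^+ 2).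
Proof. by move=> a0 b0; rewrite ler_pXn2r// nnegrE. Qed.

Lemma sqrt_gt_norm u y : 0 < u -> `|y| < Num.sqrt (u ^+ 2 + y ^+ 2).
Proof.
move=> u0; rewrite -sqrtr_sqr ltr_sqrt ?ltrDr ?exprn_gt0//.
by rewrite ltr_wpDr ?sqr_ge0 ?exprn_gt0.
Qed.

Let cone_primitive u y :=
  rho * y - 2^-1 * (y * Num.sqrt (u ^+ 2 + y ^+ 2) +
    u ^+ 2 * ln (y + Num.sqrt (u ^+ 2 + y ^+ 2))).

Lemma is_derive_cone_primitive u y : 0 < u ->
  is_derive y 1 (cone_primitive u) (rho - Num.sqrt (u ^+ 2 + y ^+ 2)).
Proof.
move=> u0.
have q0 : 0 < u ^+ 2 + y ^+ 2 by rewrite ltr_wpDr ?sqr_ge0 ?exprn_gt0.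
have s0 : 0 < Num.sqrt (u ^+ 2 + y ^+ 2) by rewrite sqrtr_gt0.
have ys0 : 0 < y + Num.sqrt (u ^+ 2 + y ^+ 2).
  by have := sqrt_gt_norm y u0; rewrite ltr_norml => /andP[h _]; lra.
have ds : is_derive y 1 (fun y => Num.sqrt (u ^+ 2 + y ^+ 2)) ((2 * Num.sqrt (u ^+ 2 + y ^+ 2))^-1 * (0 + (y * 1 + y * 1))).
  exact: (@der_sqrt R (fun y => u ^+ 2 + y * y) y _ q0 (der_add (der_cst y (u ^+ 2)) (der_mul (der_id y) (der_id y)))).
have dl := @der_ln R (fun y => y + Num.sqrt (u ^+ 2 + y ^+ 2)) y _ ys0 (der_add (der_id y) ds).
have D := der_sub (der_mul (der_cst y rho) (der_id y)) (der_mul (der_cst y 2^-1) (der_add (der_mul (der_id y) ds)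
  (der_mul (der_cst y (u ^+ 2)) dl))).
apply: (der_eq D) => {D ds}.
have s2 : Num.sqrt (u ^+ 2 + y ^+ 2) ^+ 2 = u ^+ 2 + y ^+ 2 by rewrite sqr_sqrtr// ltW.
move: s0 ys0 s2; set s := Num.sqrt _ => s0 ys0 s2.
have s0' : s != 0 by rewrite gt_eqF.
have ys0' : y + s != 0 by rewrite gt_eqF.
have u2 : u ^+ 2 = s ^+ 2 - y ^+ 2 by rewrite s2; ring.
by rewrite u2; field; rewrite s0'.
Qed.

(** On the segment where it is positive, the cone is integrated by its
    primitive [cone_primitive]. *)
Lemma chordE u : 0 < u <= rho -> chord u = (chord_value u)%:E.
Proof.
move=> /andP[u0 urho].
(* For [u = rho] the segment of integration is a point. *)
have [w0|w0] := eqVneq (half_chord u) 0.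
  have ur : u = rho.
    apply/eqP; rewrite eq_le urho/= leNgt; apply/negP => ultr.
    have := w0; rewrite /half_chord; apply/eqP; rewrite gt_eqF// sqrtr_gt0.
    by rewrite subr_gt0 ltr_pXn2r// nnegrE ltW.
  rewrite /chord integral0_eq; last first.
    move=> y _; congr (_%:E); apply/max_idPl; rewrite subr_le0 -ur.
    by rewrite -[leLHS]gtr0_norm// -sqrtr_sqr ler_wsqrtr// lerDl sqr_ge0.
  by rewrite /chord_value /= w0 ur addr0 subrr mulr0 mulr0 subrr.
have {}w0 : 0 < half_chord u by rewrite lt0r w0 sqrtr_ge0.
have w2 : half_chord u ^+ 2 = rho ^+ 2 - u ^+ 2.
  by rewrite sqr_sqrtr// subr_ge0 ler_pXn2r// nnegrE ltW.
set w := half_chord u in w0 w2 *.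
transitivity (\int[leb]_(y in `[(- w)%R, w]) (rho - Num.sqrt (u ^+ 2 + y ^+ 2))%:E)%E.
  rewrite [RHS]integral_mkcond; apply: eq_integral => y _; rewrite patchE.
  have e : (y \in `[- w, w]) = (Num.sqrt (u ^+ 2 + y ^+ 2) <= rho).
    rewrite mem_setE in_itv/= -ler_norml (le_sqr _ (ltW w0))// [RHS]le_sqr ?sqrtr_ge0 ?(ltW rho0)//.
    by rewrite real_normK ?num_real// w2 sqr_sqrtr ?addr_ge0 ?sqr_ge0// lerBrDl.
  rewrite e; case: leP => h; congr (_%:E).
    by apply/max_idPr; rewrite subr_ge0.
  by apply/max_idPl; rewrite subr_le0 ltW.
rewrite (@integral_FTC2 R _ (cone_primitive u)); first last.
- by move=> y _; exact: is_derive_cone_primitive.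
- by move=> y _; exact: (is_derive_continuous (is_derive_cone_primitive y u0)).
- move=> y _; apply: cvgB; first exact: cvg_cst.
  apply: continuous_comp; last exact: sqrt_continuous.
  by apply: cvgD; [exact: cvg_cst|exact: exprn_continuous].
- lra.
congr (_%:E); rewrite /cone_primitive /chord_value /= -/w.
have -> : u ^+ 2 + w ^+ 2 = rho ^+ 2 by rewrite w2; ring.
have -> : u ^+ 2 + (- w) ^+ 2 = rho ^+ 2 by rewrite sqrrN w2; ring.
rewrite sqrtr_sqr gtr0_norm//.
have wr : w < rho.
  by rewrite -(@ltr_pXn2r _ 2)// ?nnegrE ?ltW// w2 ltrBlDr ltrDl exprn_gt0.
have -> : ln (- w + rho) = 2 * ln u - ln (rho + w).
  have p1 : - w + rho \is Num.pos by rewrite posrE; lra.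
  have p2 : rho + w \is Num.pos by rewrite posrE; lra.
  apply/eqP; rewrite eq_sym subr_eq -lnM//.
  have -> : (- w + rho) * (rho + w) = u ^+ 2 by move: w2; lra.
  by rewrite lnXn// mulr_natl.
by rewrite [w + rho]addrC; field.
Qed.

Lemma measurable_cone2 :
  measurable_fun setT (fun x : measurableTypeR R * measurableTypeR R => Num.max 0 (rho - Num.sqrt (x.1 ^+ 2 + x.2 ^+ 2))).
Proof.
apply: measurable_maxr => //; apply: measurable_funB => //.
apply: (@measurableT_comp _ _ _ _ _ _ (@Num.sqrt R)).
  by apply: continuous_measurable_fun; exact: sqrt_continuous.
by apply: measurable_funD; apply: measurable_funX.
Qed.

Lemma measurable_cone1 u :
  measurable_fun setT (fun y : measurableTypeR R => Num.max 0 (rho - Num.sqrt (u ^+ 2 + y ^+ 2))).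
Proof.
exact: (measurableT_comp measurable_cone2 (measurable_pair1 u)).
Qed.

Lemma measurable_chord : measurable_fun setT chord.
Proof.
apply: (@measurable_fun_fubini_tonelli_F _ _ _ _ _ leb
  (fun x : measurableTypeR R * measurableTypeR R => (Num.max 0 (rho - Num.sqrt (x.1 ^+ 2 + x.2 ^+ 2)))%:E)).
  by apply/measurable_EFinP; exact: measurable_cone2.
by move=> x; rewrite lee_fin le_max lexx.
Qed.

Lemma chord_ge0 u : (0 <= chord u)%E.
Proof. by apply: integral_ge0 => y _; rewrite lee_fin le_max lexx. Qed.

Lemma chord_antitone u v : `|u| <= `|v| -> (chord v <= chord u)%E.
Proof.
move=> uv; apply: ge0_le_integral => //.
- by move=> y _; rewrite lee_fin le_max lexx.
- by apply/measurable_EFinP; exact: measurable_cone1.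
- by apply/measurable_EFinP; exact: measurable_cone1.
move=> y _; rewrite lee_fin ge_max !le_max lexx/=; apply/orP; right.
rewrite lerB// ler_wsqrtr// lerD2r.
by rewrite -(real_normK (num_real u)) -(real_normK (num_real v)) -le_sqr.
Qed.

Lemma chord_value_ge0 u : 0 < u <= rho -> 0 <= chord_value u.
Proof. by move=> /chordE; have := chord_ge0 u => /[swap] ->; rewrite lee_fin. Qed.

Lemma chord_value_antitone u v : 0 < u -> u <= v -> v <= rho ->
  chord_value v <= chord_value u.
Proof.
move=> u0 uv vr; have v0 := lt_le_trans u0 uv.
rewrite -lee_fin -!chordE ?u0 ?v0 ?vr ?(le_trans uv)//.
by apply: chord_antitone; rewrite !gtr0_norm.
Qed.

Lemma chord_le u : (chord u <= (rho * (2 * rho))%:E)%E.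
Proof.
apply: (@le_trans _ _ (\int[leb]_(y in `[(- rho)%R, rho]) (cst rho%:E y))%E).
  rewrite [leRHS]integral_mkcond; apply: ge0_le_integral => //.
  - by move=> y _; rewrite lee_fin le_max lexx.
  - by apply/measurable_EFinP; exact: measurable_cone1.
  - by apply/(measurable_restrictT _ _).1.
  move=> y _; rewrite patchE mem_setE in_itv/= -ler_norml.
  case: ifPn => [_|]; first by rewrite lee_fin ge_max (ltW rho0)/= gerBl sqrtr_ge0.
  rewrite -ltNge => h; rewrite lee_fin ge_max lexx/= subr_le0.
  by apply: (le_trans (ltW h)); rewrite -sqrtr_sqr ler_wsqrtr// lerDr sqr_ge0.
have E : leb `[(- rho)%R, rho] = (2 * rho)%:E.
  rewrite lebesgue_measure_itv/= lte_fin ifT; last by rewrite gtrN.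
  by rewrite -EFinB opprK mulr_natl mulr2n.
have -> := integral_cst leb (measurable_itv `[- rho, rho]%R) rho%:E.
by rewrite EFinM -E.
Qed.
End chord.

(** * Integral of a cone over a strip *)

Section chord_primitive.
Variable R : realType.
Notation leb := (@lebesgue_measure R).
Variable rho : R.
Hypothesis rho0 : 0 < rho.
Implicit Types u y : R.
Notation w := (half_chord rho).
Notation K := (chord_value rho).

(** The term [2 * atan (u / (rho + w u))] is the arcsine of [u / rho], by the
    half-angle formula.  In this form its continuity at [u = rho], an endpoint
    that occurs for [r = 0], is immediate. *)
Definition chord_primitive u : R :=
  (rho * u * w u + 2 * rho ^+ 3 * atan (u / (rho + w u)) + u * K u) / 3.

Lemma half_chord_sqr u : 0 < u <= rho -> w u ^+ 2 = rho ^+ 2 - u ^+ 2.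
Proof.
by move=> /andP[u0 ur]; rewrite sqr_sqrtr// subr_ge0 -(le_sqr (ltW u0) (ltW rho0)).
Qed.

Lemma is_derive_half_chord u : 0 < u < rho -> is_derive u 1 w (- u / w u).
Proof.
move=> /andP[u0 ur].
have q0 : 0 < rho * rho - u * u by rewrite subr_gt0 -!expr2 ltr_pXn2r// nnegrE ltW.
have D := @der_sqrt R (fun y => rho * rho - y * y) u _ q0 (der_sub (der_cst u (rho * rho)) (der_mul (der_id u) (der_id u))).
apply: (der_eq D); rewrite -!expr2 -/(half_chord rho u).
have w0 : half_chord rho u != 0 by rewrite gt_eqF// sqrtr_gt0.
by field.
Qed.

Lemma is_derive_chord_value u : 0 < u < rho ->
  is_derive u 1 K (- 2 * u * (ln (rho + w u) - ln u)).
Proof.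
move=> uu; have /andP[u0 ur] := uu.
have Dw := is_derive_half_chord uu.
have w0 : 0 < w u by rewrite sqrtr_gt0 subr_gt0 ltr_pXn2r// nnegrE ltW.
have rw0 : 0 < rho + w u by rewrite addr_gt0.
have w2 : w u ^+ 2 = rho ^+ 2 - u ^+ 2 by rewrite half_chord_sqr// u0 ltW.
have Dl := @der_ln R (fun y => rho + w y) u _ rw0 (der_add (der_cst u rho) Dw).
have Dlu := @der_ln R (fun y => y) u _ u0 (der_id u).
have D := der_sub (der_mul (der_cst u rho) Dw) (der_mul (der_mul (der_id u) (der_id u)) (der_sub Dl Dlu)).
apply: (der_eq D) => {D Dw Dl Dlu}.
move: w0 rw0 w2; set v := w u => w0 rw0 w2.
have v0' : v != 0 by rewrite gt_eqF.
have u0' : u != 0 by rewrite gt_eqF.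
have rv0' : rho + v != 0 by rewrite gt_eqF.
have -> : rho * (- u / v) + v * 0 = - rho * u / v by field.
have -> : (rho + v)^-1 * (0 + - u / v) - u^-1 * 1 = - rho / (u * v).
  have : u * u = rho * rho - v * v by rewrite -!expr2 w2; ring.
  move=> uE; apply: (mulIf (mulf_neq0 (mulf_neq0 rv0' u0') v0')).
  transitivity (- (u * u) - (rho + v) * v); first by field; rewrite rv0' u0' v0'.
  by rewrite uE; field; rewrite u0' v0'.
by field; rewrite u0' v0'.
Qed.

Lemma is_derive_chord_primitive u : 0 < u < rho ->
  is_derive u 1 chord_primitive (K u).
Proof.
move=> uu; have /andP[u0 ur] := uu.
have Dw := is_derive_half_chord uu.
have DK := is_derive_chord_value uu.
have w0 : 0 < w u by rewrite sqrtr_gt0 subr_gt0 ltr_pXn2r// nnegrE ltW.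
have rw0 : 0 < rho + w u by rewrite addr_gt0.
have w2 : w u ^+ 2 = rho ^+ 2 - u ^+ 2 by rewrite half_chord_sqr// u0 ltW.
have v0' : w u != 0 by rewrite gt_eqF.
have u0' : u != 0 by rewrite gt_eqF.
have r0' : rho != 0 by rewrite gt_eqF.
have rv0' : rho + w u != 0 by rewrite gt_eqF.
have uE : u * u = rho * rho - w u * w u by rewrite -!expr2 w2; ring.
have Dq : is_derive u 1 (fun y => y / (rho + w y)) (rho / (w u * (rho + w u))).
  have D := der_mul (der_id u) (@der_inv R (fun y => rho + w y) u _ rv0' (der_add (der_cst u rho) Dw)).
  apply: (der_eq D); apply: (mulIf (mulf_neq0 (mulf_neq0 rv0' rv0') v0')).
  transitivity (u * u + (rho + w u) * w u); first by field; rewrite rv0' v0'.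
  by rewrite uE; field; rewrite rv0' v0'.
have Da : is_derive u 1 (fun y => atan (y / (rho + w y))) ((2 * w u)^-1).
  apply: (der_eq (der_atan Dq)).
  have -> : 1 + (u / (rho + w u)) ^+ 2 = 2 * rho / (rho + w u).
    apply: (mulIf (mulf_neq0 rv0' rv0')).
    transitivity ((rho + w u) * (rho + w u) + u * u); first by field.
    by rewrite uE; field.
  by field; rewrite v0' r0' rv0'.
have D := der_mul (der_add (der_add (der_mul (der_mul (der_cst u rho) (der_id u)) Dw) (der_mul (der_cst u (2 * rho ^+ 3)) Da)) (der_mul (der_id u) DK)) (der_cst u 3^-1).
apply: (der_eq D) => {D Dw DK Da Dq}.
have KE : K u = rho * w u - u * u * (ln (rho + w u) - ln u) by [].
rewrite KE; move: v0' rv0' uE; set v := w u; set l := ln _ - ln _ => v0' rv0' uE.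
apply: (mulIf v0').
transitivity ((- rho * (u * u) + rho * v * v + rho ^+ 3 - 3 * v * (u * u) * l + rho * v * v) / 3).
  by field.
by rewrite uE; field.
Qed.

Lemma continuous_half_chord u : {for u, continuous w}.
Proof.
apply: continuous_comp; last exact: sqrt_continuous.
by apply: cvgB; [exact: cvg_cst|exact: exprn_continuous].
Qed.

Lemma continuous_chord_value u : 0 < u -> {for u, continuous K}.
Proof.
move=> u0; have cw := @continuous_half_chord u.
have rw0 : 0 < rho + w u by rewrite ltr_pwDl// sqrtr_ge0.
apply: cvgB; first by apply: cvgM => //; exact: cvg_cst.
apply: cvgM; first exact: exprn_continuous.
apply: cvgB; last exact: continuous_ln.
apply: (@continuous_comp _ _ _ (fun y => rho + w y) (@ln R)); last exact: continuous_ln.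
by apply: cvgD => //; exact: cvg_cst.
Qed.

Lemma continuous_chord_primitive u : 0 < u -> {for u, continuous chord_primitive}.
Proof.
move=> u0; have cw := @continuous_half_chord u.
have rw0 : 0 < rho + w u by rewrite ltr_pwDl// sqrtr_ge0.
apply: cvgM; last exact: cvg_cst.
apply: cvgD; last by apply: cvgM; [exact: cvg_id|exact: continuous_chord_value].
apply: cvgD.
  apply: cvgM => //; apply: cvgM; [exact: cvg_cst|exact: cvg_id].
apply: cvgM; first exact: cvg_cst.
apply: (@continuous_comp _ _ _ (fun y => y / (rho + w y)) (@atan R)); last exact: continuous_atan.
apply: cvgM; first exact: cvg_id.
apply: cvgV; first by rewrite gt_eqF.
by apply: cvgD => //; exact: cvg_cst.
Qed.

Lemma chord_primitive_ge0 u : 0 < u <= rho -> 0 <= chord_primitive u.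
Proof.
move=> uu; have /andP[u0 ur] := uu.
have w0 : 0 <= w u := sqrtr_ge0 _.
have K0 := chord_value_ge0 rho0 uu.
rewrite divr_ge0// !addr_ge0// mulr_ge0 ?(ltW u0)//.
- by rewrite mulr_ge0 ?ltW.
- by rewrite mulr_ge0// exprn_ge0// ltW.
- rewrite -(atan0 R) le_atan// divr_ge0 ?ltW//.
  by rewrite ltr_pwDl.
Qed.

(** The logarithm of [chord_value] is singular at [0], hence the lower
    endpoint [e]; the value of the primitive there is nonnegative and is
    dropped. *)
Lemma integral_chord_excess (e a : R) : 0 < e -> e < a -> a <= rho ->
  (\int[leb]_(u in `[e, a]) (K u - K a)%:E <=
     (chord_primitive a - K a * (a - e))%:E)%E.
Proof.
move=> e0 ea ar; have a0 := lt_trans e0 ea.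
rewrite (@integral_FTC2 R _ (fun u => chord_primitive u - K a * u))//.
- rewrite lee_fin; have : 0 <= chord_primitive e by rewrite chord_primitive_ge0// e0 (le_trans _ ar)// ltW.
  lra.
- move=> u; rewrite in_itv/= => /andP[eu _].
  by apply: cvgB; [apply: continuous_chord_value; exact: lt_le_trans eu|exact: cvg_cst].
- move=> u; rewrite in_itv/= => /andP[eu _].
  apply: cvgB; first by apply: continuous_chord_primitive; exact: lt_le_trans eu.
  by apply: cvgM; [exact: cvg_cst|exact: cvg_id].
- move=> u; rewrite in_itv/= => /andP[eu ua].
  have uu : 0 < u < rho by rewrite (lt_trans e0 eu) (lt_le_trans ua).
  have D := der_sub (is_derive_chord_primitive uu) (der_mul (der_cst u (K a)) (der_id u)).
  by apply: (der_eq D); rewrite mulr0 addr0 mulr1.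
Qed.

End chord_primitive.

Section strip.
Variable R : realType.
Notation leb := (@lebesgue_measure R).
Notation P := (measurableTypeR R * measurableTypeR R)%type.
Variable rho : R.
Hypothesis rho0 : 0 < rho.
Implicit Types u y : R.
Notation w := (half_chord rho).
Notation K := (chord_value rho).

Lemma measurable_chord_value : measurable_fun setT (K : R -> R).
Proof.
have mw : measurable_fun setT (w : R -> R).
  apply: (@measurableT_comp _ _ _ _ _ _ (@Num.sqrt R)).
    by apply: continuous_measurable_fun; exact: sqrt_continuous.
  by apply: measurable_funB => //; exact: measurable_funX.
apply: measurable_funB; first exact: measurable_funM.
apply: measurable_funM; first exact: measurable_funX.
apply: measurable_funB; last exact: measurable_ln.
by apply: (measurableT_comp (@measurable_ln R)); exact: measurable_funD.
Qed.

Lemma integral_itv_cst (c a b : R) : a <= b ->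
  (\int[leb]_(u in `[a, b]) (cst c%:E u) = (c * (b - a))%:E)%E.
Proof.
move=> ab; have -> := integral_cst leb (measurable_itv `[a, b]%R) c%:E.
have E : leb `[a, b] = (b - a)%:E.
  rewrite lebesgue_measure_itv/= lte_fin; case: ltP => //.
  by move=> ba; rewrite (@le_anti _ _ a b) ?ab ?subrr.
by rewrite EFinM -E.
Qed.

(** Since [chord] decreases, its integral up to [s] is a concave function of
    [s]; this is its tangent line at [s = a].  The excess [chord u - chord a]
    is positive only for [u < a], and near [0] a constant bound for [chord]
    suffices. *)
Lemma integral_chord_half (a s : R) : 0 < a <= rho -> 0 <= s ->
  (\int[leb]_(u in `[0%R, s]) chord rho u <=
    (K a * s + (chord_primitive rho a - K a * a))%:E)%E.
Proof.
move=> aa s0; have /andP[a0 ar] := aa.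
have K0 := chord_value_ge0 rho0 aa.
set C := rho * (2 * rho).
have C0 : 0 < C by rewrite !mulr_gt0.
apply/lee_addgt0Pr => e e0.
(* The error made on [0, e'] is at most [(K a + C) * e']. *)
pose e' := Num.min (a / 2) (e / (K a + C)).
have KC : 0 < K a + C by rewrite ltr_wpDl.
have e'0 : 0 < e' by rewrite lt_min !divr_gt0.
have e'a : e' < a.
  apply: (@le_lt_trans _ _ (a / 2)); first by rewrite ge_min lexx.
  by rewrite ltr_pdivrMr// ltr_pMr// ltr1n.
have e'e : (K a + C) * e' <= e.
  by rewrite mulrC -ler_pdivlMr// ge_min lexx orbT.
pose I1 := `[0%R, s]%classic; pose I2 := `[0%R, e']%classic; pose I3 := `[e', a]%classic.
pose f1 := (cst (K a)%:E \_ I1)%E.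
pose f2 := (cst C%:E \_ I2)%E.
pose f3 := ((fun u => (K u - K a)%:E) \_ I3)%E.
have mI1 : measurable I1 by exact: measurable_itv.
have mI2 : measurable I2 by exact: measurable_itv.
have mI3 : measurable I3 by exact: measurable_itv.
have mf1 : measurable_fun setT f1 by apply/(measurable_restrictT _ _).1.
have mf2 : measurable_fun setT f2 by apply/(measurable_restrictT _ _).1.
have mf3 : measurable_fun setT f3.
  apply/(measurable_restrictT _ _).1 => //; apply: measurable_funTS.
  by apply/measurable_EFinP; apply: measurable_funB => //; exact: measurable_chord_value.
have f10 u : (0 <= f1 u)%E.
  by rewrite /f1 patchE; case: ifP => // _; rewrite lee_fin.
have f20 u : (0 <= f2 u)%E.
  by rewrite /f2 patchE; case: ifP => // _; rewrite lee_fin ltW.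
have f30 u : (0 <= f3 u)%E.
  rewrite /f3 patchE; case: ifP => //; rewrite mem_setE in_itv/= => /andP[h1 h2].
  by rewrite lee_fin subr_ge0 chord_value_antitone// (lt_le_trans e'0).
have f230 u : (0 <= f2 u + f3 u)%E by exact: adde_ge0.
apply: (@le_trans _ _ (\int[leb]_u (f1 u + (f2 u + f3 u)))%E).
  rewrite integral_mkcond; apply: ge0_le_integral => //.
  - by move=> u _; rewrite patchE; case: ifP => // _; exact: chord_ge0.
  - apply/(measurable_restrictT _ _).1 => //; apply: measurable_funTS.
    exact: measurable_chord.
  - by apply: emeasurable_funD => //; exact: emeasurable_funD.
  move=> u _; rewrite patchE; case: ifPn => [uI|_]; last exact: adde_ge0.
  move: (uI); rewrite mem_setE in_itv/= => /andP[u0 us].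
  have [ue|eu] := leP u e'.
    apply: (@le_trans _ _ (f2 u)); last first.
      by rewrite addeCA leeDl// adde_ge0.
    rewrite /f2 patchE ifT; first exact: chord_le.
    by rewrite mem_setE in_itv/= u0.
  have u0' := lt_trans e'0 eu.
  have f1E : f1 u = (K a)%:E by rewrite /f1 patchE uI.
  have [ua|au] := leP u a.
    rewrite chordE// ?u0' ?(le_trans ua)// f1E.
    have -> : f3 u = (K u - K a)%:E.
      by rewrite /f3 patchE ifT// mem_setE in_itv/= ua ltW.
    by rewrite addeCA -EFinD (addrC (K a)) subrK leeDr.
  apply: (@le_trans _ _ (chord rho a)).
    by apply: chord_antitone => //; rewrite !ger0_norm// ltW.
  by rewrite chordE// -f1E leeDl.
rewrite ge0_integralD//; last exact: emeasurable_funD.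
rewrite ge0_integralD//.
rewrite /f1 /f2 /f3 -!integral_mkcond !integral_itv_cst ?subr0 ?(ltW e'0)//.
apply: (@le_trans _ _ ((K a * s)%:E + ((C * e')%:E + (chord_primitive rho a - K a * (a - e'))%:E))%E).
  by do 2 apply: leeD => //; exact: integral_chord_excess.
by rewrite -!EFinD lee_fin; lra.
Qed.

Definition cone (x : R * R) : R := Num.max 0 (rho - enorm x).

Lemma cone_ge0 x : 0 <= cone x. Proof. by rewrite le_max lexx. Qed.

Lemma measurable_cone : measurable_fun setT (cone : P -> R).
Proof. exact: measurable_cone2. Qed.

(** Slice the strip by vertical lines; the two halves are mirror images. *)
Lemma integral_strip (a s : R) : 0 < a <= rho -> 0 <= s ->
  (\int[@borel_area R]_x (if (- s < x.1 <= s)%R then cone x else 0)%:E <=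
   (2 * (K a * s + (chord_primitive rho a - K a * a)))%:E)%E.
Proof.
move=> aa s0.
have mb : measurable_fun setT (fun x : P => (- s < x.1 <= s)%R).
  apply: measurable_and.
    by apply: measurable_fun_ltr.
  by apply: measurable_fun_ler.
have mst : measurable_fun setT (fun x : P => if (- s < x.1 <= s)%R then cone x else 0).
  by apply: measurable_fun_ifT => //; exact: measurable_cone.
have E := @integral_borel_area1 R (fun x : P => (if (- s < x.1 <= s)%R then cone x else 0)%:E).
rewrite E; first last.
- by move=> x; rewrite lee_fin; case: ifP => // _; exact: cone_ge0.
- by apply/measurable_EFinP.
pose g := (chord rho \_ `[0%R, s])%E.
have mg : measurable_fun setT g.
  by apply/(measurable_restrictT _ _).1 => //; apply: measurable_funTS; exact: measurable_chord.
have g0 u : (0 <= g u)%E by rewrite /g patchE; case: ifP => // _; exact: chord_ge0.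
have mgN : measurable_fun setT (fun u => g (- u)) by exact: (measurableT_comp mg).
have key (u : R) :
    (\int[leb]_y (if - s < u <= s then cone (u, y) else 0)%:E <= g u + g (- u)%R)%E.
  case: (boolP (- s < u <= s)) => h; last first.
    by rewrite integral0_eq ?adde_ge0.
  have /andP[su us] := h.
  apply: (@le_trans _ _ (chord rho u)); first by [].
  have [u0|u0] := leP 0 u.
    have -> : g u = chord rho u by rewrite /g patchE ifT// mem_setE in_itv/= u0.
    by rewrite leeDl.
  have -> : g (- u) = chord rho (- u).
    by rewrite /g patchE ifT// mem_setE in_itv/= oppr_ge0 ltW//= lerNl ltW.
  apply: (@le_trans _ _ (chord rho (- u))); last by rewrite leeDr.
  by apply: chord_antitone => //; rewrite normrN.
apply: (@le_trans _ _ (\int[leb]_u (g u + g (- u)%R))%E).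
  apply: ge0_le_integral => //.
  - move=> u _; apply: integral_ge0 => y _; rewrite lee_fin.
    by case: ifP => // _; exact: cone_ge0.
  - apply: (@measurable_fun_fubini_tonelli_F _ _ _ _ _ leb
      (fun x : P => (if (- s < x.1 <= s)%R then cone x else 0)%:E)).
      by apply/measurable_EFinP.
    by move=> x; rewrite lee_fin; case: ifP => // _; exact: cone_ge0.
  - exact: (emeasurable_funD mg mgN).
  by move=> u _; exact: key.
rewrite ge0_integralD//.
have -> : (\int[leb]_u g (- u)%R = \int[leb]_u g u)%E := integral_reflect mg g0.
rewrite mulr_natl mulr2n EFinD.
by apply: leeD; rewrite /g -integral_mkcond; exact: integral_chord_half.
Qed.
End strip.

(** * Gain of a second cone *)

Section gain.
Variable R : realType.
Notation P := (measurableTypeR R * measurableTypeR R)%type.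
Variable rho : R.
Hypothesis rho0 : 0 < rho.
Notation K := (chord_value rho).

Lemma enorm_antitone_cone (x y : R * R) : enorm x <= enorm y -> cone rho y <= cone rho x.
Proof.
move=> xy; rewrite /cone ge_max !le_max lexx/=; apply/orP; right.
by rewrite lerB.
Qed.

Lemma norm1_enorm (x : R * R) : `|x.1| <= enorm x.
Proof. by rewrite -sqrtr_sqr ler_wsqrtr// lerDl sqr_ge0. Qed.

(** The cone vanishes outside the strip of half-width [rho]. *)
Lemma integral_cone (a : R) : 0 < a <= rho ->
  (\int[@borel_area R]_x (cone rho x)%:E <=
   (2 * (K a * rho + (chord_primitive rho a - K a * a)))%:E)%E.
Proof.
move=> aa; apply: le_trans (integral_strip rho0 aa (ltW rho0)).
rewrite le_eqVlt; apply/orP; left; apply/eqP; apply: eq_integral => -[u v] _ /=.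
congr (_%:E); case: ifPn => // h; apply/max_idPl; rewrite subr_le0.
apply: le_trans (norm1_enorm _); rewrite /= leNgt.
by apply: contra h; rewrite ltr_norml => /andP[-> /ltW ->].
Qed.

(** What a second cone, with apex [v], adds to the cone with apex at the
    origin. *)
Definition cone_gain (v x : R * R) : R := Num.max 0 (cone rho (x - v) - cone rho x).

Lemma measurable_cone_shift (p : R * R) : measurable_fun setT (fun x : P => cone rho (x - p)).
Proof.
apply: (measurableT_comp (measurable_cone rho)).
by apply: measurable_fun_pair; apply: measurable_funB.
Qed.

Lemma measurable_cone_gain v : measurable_fun setT (cone_gain v : P -> R).
Proof.
apply: measurable_maxr => //; apply: measurable_funB; last exact: measurable_cone.
exact: measurable_cone_shift.
Qed.

Lemma cone_gain_ge0 v x : 0 <= cone_gain v x. Proof. by rewrite le_max lexx. Qed.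

(** Beyond the perpendicular bisector [x.1 = d / 2] of the two apexes the
    shifted cone dominates the centred one, and before it the gain vanishes.
    The integral of the shifted cone beyond the bisector is the integral of the
    centred cone over the half-plane [- (d / 2) < x.1]; so the gain is the
    integral of the centred cone over the strip [- (d / 2) < x.1 <= d / 2]. *)
Lemma integral_cone_gain_horizontal (a d : R) : 0 < a <= rho -> 0 <= d ->
  (\int[@borel_area R]_x (cone_gain (d, 0%R) x)%:E <=
   (K a * d + 2 * (chord_primitive rho a - K a * a))%:E)%E.
Proof.
move=> aa d0.
pose t (x : R * R) : R := if d / 2 < x.1 then cone rho x else 0.
pose u (x : R * R) : R := if - (d / 2) < x.1 then cone rho x else 0.
pose st (x : R * R) : R := if - (d / 2) < x.1 <= d / 2 then cone rho x else 0.
have mt : measurable_fun setT (t : P -> R).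
  by apply: measurable_fun_ifT => //; [exact: measurable_fun_ltr|exact: measurable_cone].
have mu : measurable_fun setT (u : P -> R).
  by apply: measurable_fun_ifT => //; [exact: measurable_fun_ltr|exact: measurable_cone].
have mst : measurable_fun setT (st : P -> R).
  apply: measurable_fun_ifT => //; last exact: measurable_cone.
  by apply: measurable_and; [exact: measurable_fun_ltr|exact: measurable_fun_ler].
have t0 x : 0 <= t x by rewrite /t; case: ifP => // _; exact: cone_ge0.
have u0 x : 0 <= u x by rewrite /u; case: ifP => // _; exact: cone_ge0.
have st0 x : 0 <= st x by rewrite /st; case: ifP => // _; exact: cone_ge0.
have e1 x : u (x - (d, 0%R)) = cone_gain (d, 0%R) x + t x.
  rewrite /u /t /cone_gain /=.
  have -> : (- (d / 2) < x.1 - d) = (d / 2 < x.1) by apply/idP/idP; lra.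
  case: ltP => h.
    have : cone rho x <= cone rho (x - (d, 0%R)).
      apply: enorm_antitone_cone; rewrite /enorm ler_wsqrtr//= subr0 lerD2r.
      rewrite -subr_ge0; have -> : x.1 ^+ 2 - (x.1 - d) ^+ 2 = d * (2 * x.1 - d) by ring.
      by apply: mulr_ge0 => //; lra.
    by move=> h'; rewrite (max_idPr _) ?subr_ge0// subrK.
  rewrite addr0 (max_idPl _)// subr_le0.
  apply: enorm_antitone_cone; rewrite /enorm ler_wsqrtr//= subr0 lerD2r.
  rewrite -subr_ge0; have -> : (x.1 - d) ^+ 2 - x.1 ^+ 2 = d * (d - 2 * x.1) by ring.
  by apply: mulr_ge0 => //; lra.
have e2 x : u x = st x + t x.
  rewrite /u /t /st; have [h1|h1] := ltP (d / 2) x.1.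
    rewrite andbF add0r ifT//; apply: le_lt_trans h1; lra.
  by rewrite andbT addr0.
have gE : measurable_fun setT (EFin \o cone_gain (d, 0%R) : P -> _).
  by apply/measurable_EFinP; exact: measurable_cone_gain.
have tE : measurable_fun setT (EFin \o t : P -> _) by apply/measurable_EFinP.
have stE : measurable_fun setT (EFin \o st : P -> _) by apply/measurable_EFinP.
have uE : measurable_fun setT (EFin \o u : P -> _) by apply/measurable_EFinP.
have g0E x : setT x -> (0 <= (EFin \o cone_gain (d, 0%R)) x)%E by rewrite lee_fin cone_gain_ge0.
have t0E x : setT x -> (0 <= (EFin \o t) x)%E by rewrite lee_fin.
have st0E x : setT x -> (0 <= (EFin \o st) x)%E by rewrite lee_fin.
have I1 : (\int[@borel_area R]_x (EFin \o u) x = \int[@borel_area R]_x (EFin \o cone_gain (d, 0%R)) x + \int[@borel_area R]_x (EFin \o t) x)%E.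
  transitivity (\int[@borel_area R]_x ((EFin \o cone_gain (d, 0%R)) x + (EFin \o t) x))%E.
    rewrite -(integral_translation2 (d, 0%R) uE); last by move=> x; rewrite lee_fin.
    by apply: eq_integral => x _ /=; rewrite e1 EFinD.
  exact (@ge0_integralD _ P R (@borel_area R) setT measurableT _ _ g0E gE t0E tE).
have I2 : (\int[@borel_area R]_x (EFin \o u) x = \int[@borel_area R]_x (EFin \o st) x + \int[@borel_area R]_x (EFin \o t) x)%E.
  transitivity (\int[@borel_area R]_x ((EFin \o st) x + (EFin \o t) x))%E.
    by apply: eq_integral => x _ /=; rewrite e2 EFinD.
  exact (@ge0_integralD _ P R (@borel_area R) setT measurableT _ _ st0E stE t0E tE).
(* The common half-plane integral [t] is finite and can be cancelled. *)
have tfin : (\int[@borel_area R]_x (EFin \o t) x)%E \is a fin_num.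
  rewrite ge0_fin_numE; last by apply: integral_ge0.
  apply: le_lt_trans (le_lt_trans (integral_cone aa) (ltry _)).
  apply: ge0_le_integral => //.
  - by apply/measurable_EFinP; exact: measurable_cone.
  - by move=> x _; rewrite lee_fin /t; case: ifP => // _; exact: cone_ge0.
have -> : (\int[@borel_area R]_x (cone_gain (d, 0%R) x)%:E = \int[@borel_area R]_x (st x)%:E)%E.
  move: I1; rewrite I2 => /(congr1 (fun z => z - \int[@borel_area R]_x (EFin \o t) x)%E).
  by rewrite !addeK// => ->.
have s0 : 0 <= d / 2 by rewrite divr_ge0.
apply: le_trans (integral_strip rho0 aa s0) _.
by rewrite lee_fin; lra.
Qed.

(** A translation brings [p] to the origin, and a rotation then brings [q] to
    the positive horizontal axis. *)
Lemma integral_cone_gain (a : R) (p q : R * R) : 0 < a <= rho ->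
  (\int[@borel_area R]_x (Num.max 0 (cone rho (x - q) - cone rho (x - p)))%:E <=
   (K a * euclid_dist p q + 2 * (chord_primitive rho a - K a * a))%:E)%E.
Proof.
move=> aa; pose v := q - p; pose d := enorm v.
have d0 : 0 <= d := sqrtr_ge0 _.
have d2 : d ^+ 2 = v.1 ^+ 2 + v.2 ^+ 2 by rewrite sqr_sqrtr// addr_ge0// sqr_ge0.
(* The direction of [q - p]; it is arbitrary when [p = q]. *)
have [c [s [cs vc vs]]] : exists c s, [/\ c ^+ 2 + s ^+ 2 = 1, v.1 = c * d & v.2 = s * d].
  have [dz|dn] := eqVneq d 0.
    have : v.1 ^+ 2 + v.2 ^+ 2 == 0 by rewrite -d2 dz expr0n.
    rewrite paddr_eq0 ?sqr_ge0// !sqrf_eq0 => /andP[/eqP v1 /eqP v2].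
    by exists 1, 0; rewrite expr1n expr0n addr0 mul0r dz mulr0.
  exists (v.1 / d), (v.2 / d); rewrite !divfK//; split => //.
  by rewrite !expr_div_n -mulrDl -d2 divff// expf_neq0.
have mgE : measurable_fun setT (EFin \o cone_gain v : P -> _).
  by apply/measurable_EFinP; exact: measurable_cone_gain.
have g0 x : (0 <= (EFin \o cone_gain v) x)%E by rewrite lee_fin cone_gain_ge0.
have -> : (\int[@borel_area R]_x (Num.max 0 (cone rho (x - q) - cone rho (x - p)))%:E =
    \int[@borel_area R]_x (cone_gain (d, 0%R) x)%:E)%E.
  transitivity (\int[@borel_area R]_x (EFin \o cone_gain v) x)%E.
    rewrite -(integral_translation2 p mgE g0); apply: eq_integral => x _ /=.
    by rewrite /cone_gain /v opprB addrA subrK.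
  rewrite -(integral_rotation cs mgE g0); apply: eq_integral => -[x y] _ /=.
  have rot (a1 b1 : R) : enorm (c * a1 - s * b1, s * a1 + c * b1) = enorm (a1, b1).
    rewrite /enorm /=; congr Num.sqrt.
    transitivity ((c ^+ 2 + s ^+ 2) * (a1 ^+ 2 + b1 ^+ 2)); first by ring.
    by rewrite cs mul1r.
  rewrite /cone_gain /cone rot.
  have -> : (c * x - s * y, s * x + c * y) - v = (c * (x - d) - s * (y - 0), s * (x - d) + c * (y - 0)).
    rewrite (surjective_pairing v) vc vs; congr (_, _) => /=; ring.
  by rewrite rot.
have -> : euclid_dist p q = d.
  by rewrite /euclid_dist /d /v /enorm /=; congr Num.sqrt; ring.
exact: integral_cone_gain_horizontal.
Qed.
End gain.

(** * The optimality equation *)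

Section optimality.
Variable R : realType.
Implicit Types x y r : R.

(** The function [log_tan] of the first quadrant, written so that its
    derivative is immediate. *)
Definition ell x : R := ln (1 + sin x) - ln (cos x).

Lemma pihalf_gt0 : 0 < pi / 2 :> R. Proof. by rewrite divr_gt0 ?pi_gt0. Qed.

Lemma cos_gt0 x : 0 <= x < pi / 2 -> 0 < cos x.
Proof.
move=> /andP[x0 xp]; apply: cos_gt0_pihalf; rewrite xp andbT.
by apply: lt_le_trans x0; rewrite oppr_lt0 pihalf_gt0.
Qed.

Lemma sin_ge0 x : 0 <= x < pi / 2 -> 0 <= sin x.
Proof.
move=> /andP[x0 xp]; apply: sin_ge0_pi; rewrite x0/=.
by apply: (le_trans (ltW xp)); rewrite ler_pdivrMr// ler_peMr ?pi_ge0 ?ler1n.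
Qed.

(** Half-angle formula: [tan (pi / 4 + x / 2) = (1 + sin x) / cos x]. *)
Lemma log_tanE x : 0 <= x < pi / 2 -> log_tan x = ell x.
Proof.
move=> xx; have /andP[x0 xp] := xx; have c0 := cos_gt0 xx; have s0 := sin_ge0 xx.
have pi0 := @pi_gt0 R.
pose y := pi / 4 + x / 2.
have yy : 0 <= y < pi / 2 by rewrite /y; apply/andP; split; lra.
have cy := cos_gt0 yy.
have ey : y *+ 2 = x + pi / 2 by rewrite /y mulr2n; lra.
have c2 : cos x = 2 * sin y * cos y.
  by rewrite -sinDpihalf -ey sin_mulr2n mulr2n; ring.
have s2 : sin x = 2 * sin y ^+ 2 - 1.
  have := cosDpihalf x; rewrite -ey cos_mulr2n cos2sin2 mulr2n => h.
  by lra.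
rewrite /log_tan -/y /ell -ln_div ?posrE//; last by rewrite ltr_wpDr.
congr ln; rewrite /tan s2 c2.
have sy : sin y != 0.
  by apply: contraTneq c0 => sy0; rewrite c2 sy0 mulr0 mul0r ltxx.
by field; rewrite sy gt_eqF.
Qed.

Lemma is_derive_ell x : - (pi / 2) < x < pi / 2 -> is_derive x 1 ell (cos x)^-1.
Proof.
move=> xx; have c0 := cos_gt0_pihalf xx.
have cs := cos2Dsin2 x.
have s1 : 0 < 1 + sin x.
  rewrite ltNge; apply/negP => h.
  have : 0 < cos x ^+ 2 by rewrite exprn_gt0.
  have := sin_geN1 x; nra.
have D := der_sub (@der_ln R (fun x => 1 + sin x) x _ s1 (der_add (der_cst x 1) (is_derive_sin x)))
  (@der_ln R (@cos R) x _ c0 (is_derive_cos x)).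
apply: (der_eq D).
have c0' : cos x != 0 by rewrite gt_eqF.
have s1' : 1 + sin x != 0 by rewrite gt_eqF.
apply: (mulIf (mulf_neq0 c0' s1')).
transitivity (cos x ^+ 2 + sin x ^+ 2 + sin x); first by field; rewrite c0' s1'.
by rewrite cs; field.
Qed.

Lemma ell0 : ell 0 = 0. Proof. by rewrite /ell sin0 cos0 addr0 subrr. Qed.

Lemma derive_pos_lt (f f' : R -> R) x y : x < y ->
  (forall z, x <= z <= y -> {for z, continuous f}) ->
  (forall z, x < z < y -> is_derive z 1 f (f' z)) ->
  (forall z, x < z < y -> 0 < f' z) -> f x < f y.
Proof.
move=> xy cf df f'0.
have wf : {within `[x, y], continuous f}.
  apply: continuous_in_subspaceT => z /[!(@mem_setE R)]; rewrite in_itv/= => zz.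
  exact: cf.
have df' z : z \in `]x, y[%R -> is_derive z 1 f (f' z) by rewrite in_itv/=; exact: df.
have [z] := MVT xy df' wf.
rewrite in_itv/= => zz e; rewrite -subr_gt0 e mulr_gt0 ?subr_gt0//.
exact: f'0.
Qed.

Lemma ell_gt0 x : 0 < x < pi / 2 -> 0 < ell x.
Proof.
move=> /andP[x0 xp]; rewrite -ell0.
have h z : 0 <= z <= x -> - (pi / 2) < z < pi / 2.
  by move=> /andP[z0 zx]; have := pihalf_gt0; rewrite (le_lt_trans zx)// andbT; lra.
have h' z : 0 < z < x -> 0 <= z <= x by move=> /andP[? ?]; rewrite !ltW.
apply: (@derive_pos_lt ell (fun z => (cos z)^-1) 0 x x0) => z zz.
- exact: (is_derive_continuous (is_derive_ell (h _ zz))).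
- exact: (is_derive_ell (h _ (h' _ zz))).
- by rewrite invr_gt0; apply: cos_gt0_pihalf; exact: (h _ (h' _ zz)).
Qed.

Lemma ell_ge0 x : 0 <= x < pi / 2 -> 0 <= ell x.
Proof.
move=> /andP[]; rewrite le_eqVlt => /predU1P[<-|x0 xp]; first by rewrite ell0.
by apply/ltW/ell_gt0; rewrite x0.
Qed.

Lemma cos_sqr_ell_le x : 0 <= x < pi / 2 -> cos x ^+ 2 * ell x <= 2 * cos x.
Proof.
move=> xx; have c0 := cos_gt0 xx; have s0 := sin_ge0 xx.
have s1 := sin_le1 x.
have h : ell x <= 2 / cos x.
  rewrite /ell -ln_div ?posrE ?ltr_wpDr//.
  apply: le_trans (ltW (ln_sublinear _)) _; first by rewrite divr_gt0// ltr_wpDr.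
  by rewrite ler_pM2r ?invr_gt0//; lra.
rewrite expr2 -mulrA mulrC ler_pM2r//.
by rewrite mulrC -ler_pdivlMr.
Qed.

(** Area of the unit disc truncated by two opposite chords of half-angle
    [x]. *)
Definition area_factor x : R := sin (2 * x) + (pi - 2 * x).

(** Up to the factor [pi - 2 * x], this is the limit of [(n - 2) * H n r x]
    as [n] grows. *)
Definition optimality r x : R :=
  sin x - cos x ^+ 2 * ell x - r * area_factor x.

Lemma is_derive_optimality r x : - (pi / 2) < x < pi / 2 ->
  is_derive x 1 (optimality r) (2 * cos x * sin x * ell x + 4 * r * sin x ^+ 2).
Proof.
move=> xx; have c0 := cos_gt0_pihalf xx.
have cs := cos2Dsin2 x.
have D2 : is_derive x 1 (fun x => sin (2 * x)) (cos (2 * x) * 2).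
  have D := @der_comp R (@sin R) (fun x => 2 * x) x _ _ (is_derive_sin (2 * x)) (der_mul (der_cst x 2) (der_id x)).
  by apply: (der_eq D); ring.
have D := der_sub (der_sub (is_derive_sin x) (der_mul (der_mul (is_derive_cos x) (is_derive_cos x)) (is_derive_ell xx)))
  (der_mul (der_cst x r) (der_add D2 (der_sub (der_cst x pi) (der_mul (der_cst x 2) (der_id x))))).
apply: (der_eq D).
have -> : cos (2 * x) = 1 - 2 * sin x ^+ 2.
  by rewrite mulr_natl cos_mulr2n cos2sin2 mulr2n; ring.
by field; rewrite gt_eqF.
Qed.

Lemma optimality_lt r x y : 0 <= r -> 0 <= x -> x < y -> y < pi / 2 ->
  optimality r x < optimality r y.
Proof.
move=> r0 x0 xy yp.
have h z : x <= z <= y -> - (pi / 2) < z < pi / 2.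
  by move=> /andP[z0 zx]; have := pihalf_gt0; rewrite (le_lt_trans zx)// andbT; lra.
have h' z : x < z < y -> x <= z <= y by move=> /andP[? ?]; rewrite !ltW.
apply: (@derive_pos_lt (optimality r) (fun x => 2 * cos x * sin x * ell x + 4 * r * sin x ^+ 2) x y xy) => z zz.
- exact: (is_derive_continuous (is_derive_optimality r (h _ zz))).
- exact: (is_derive_optimality r (h _ (h' _ zz))).
- have /andP[xz zy] := zz.
  have zp : 0 < z < pi / 2 by rewrite (le_lt_trans x0 xz) (lt_trans zy).
  have c0 := cos_gt0_pihalf (h _ (h' _ zz)).
  have s0 := sin_gt0_pihalf zp.
  have e0 := ell_gt0 zp.
  apply: ltr_wpDr; first by rewrite mulr_ge0 ?sqr_ge0// mulr_ge0.
  by rewrite !mulr_gt0.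
Qed.

(** The value at [0] is [- r * pi].  By [cos_sqr_ell_le] the function is close
    to [1] near [pi / 2], where [ell] itself is unbounded. *)
Lemma optimality_root r : 0 <= r ->
  exists2 x, 0 <= x < pi / 2 & optimality r x = 0.
Proof.
move=> r0.
pose Q x := sin x - 2 * cos x - r * area_factor x.
have D2 x : is_derive x 1 (fun x => sin (2 * x)) (cos (2 * x) * 2).
  have D := @der_comp R (@sin R) (fun x => 2 * x) x _ _ (is_derive_sin (2 * x)) (der_mul (der_cst x 2) (der_id x)).
  by apply: (der_eq D); ring.
have cQ : {for (pi / 2), continuous Q}.
  have D := der_sub (der_sub (is_derive_sin (pi / 2 : R)) (der_mul (der_cst _ 2) (is_derive_cos (pi / 2 : R))))
  (der_mul (der_cst _ r) (der_add (D2 (pi / 2)) (der_sub (der_cst _ pi) (der_mul (der_cst _ 2) (der_id _))))).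
  exact: (is_derive_continuous D).
have Q1 : Q (pi / 2) = 1.
  have e : 2 * (pi / 2) = pi :> R by lra.
  by rewrite /Q /area_factor cos_pihalf sin_pihalf e sinpi subrr addr0 !mulr0 !subr0.
have : \forall x \near (pi / 2 : R), 0 < Q x.
  by move/cvgrPdist_lt : cQ => /(_ 1 ltr01); apply: filterS => x /=; rewrite Q1 ltr_norml => /andP[_]; lra.
move=> /nbhs_ballP[e /= e0 he].
have p0 := pihalf_gt0.
pose y := pi / 2 - Num.min (e / 2) (pi / 4 : R).
have m0 : 0 < Num.min (e / 2) (pi / 4 : R) by rewrite lt_min !divr_gt0 ?pi_gt0.
have m1 : Num.min (e / 2) (pi / 4 : R) < e by rewrite gt_min; apply/orP; left; lra.
have m2 : Num.min (e / 2) (pi / 4 : R) <= pi / 4 by rewrite ge_min lexx orbT.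
have yy : 0 <= y < pi / 2 by rewrite /y; apply/andP; split; lra.
have Qy : 0 < Q y.
  by apply: he; rewrite /ball/= /y opprB addrC subrK gtr0_norm.
have Py : 0 < optimality r y.
  by apply: lt_le_trans Qy _; rewrite /Q /optimality lerD2r lerD2l lerN2 cos_sqr_ell_le.
have P0 : optimality r 0 <= 0.
  rewrite /optimality /area_factor ell0 !mulr0 sin0.
  by have := mulr_ge0 r0 (@pi_ge0 R); lra.
have /andP[y0 yp] := yy.
have [||x] := @IVT R (optimality r) 0 y 0 y0.
- apply: continuous_in_subspaceT => z /[!(@mem_setE R)]; rewrite in_itv/= => /andP[z0 zy].
  apply: (is_derive_continuous (is_derive_optimality r _)).
  by rewrite (le_lt_trans zy)// andbT; lra.
- by rewrite ge_min P0 le_max (ltW Py) orbT.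
rewrite in_itv/= => /andP[x0 xy] Px; exists x => //.
by apply/andP; split => //; exact: le_lt_trans xy yp.
Qed.
End optimality.

(** * The roots as the number of sides grows *)

Section roots.
Variable R : realType.
Implicit Types x y n r alpha : R.

Lemma is_derive0_slope (f : R -> R) (l : R) : f 0 = 0 -> is_derive (0 : R) 1 f l ->
  f x / x @[x --> 0^'] --> l.
Proof.
move=> f0 [df <-]; have : h^-1 *: (f (h *: 1 + 0) - f 0) @[h --> 0^'] --> 'D_1 f 0 := df.
apply: cvg_trans; apply: near_eq_cvg; near=> x.
by rewrite f0 subr0 addr0 /GRing.scale/= mulr1 mulrC.
Unshelve. all: by end_near. Qed.

Definition sin_ratio x : R := sin x / x.
Definition ell_ratio x : R := cos x ^+ 2 * ell x / x.

Lemma cvg_cos0 : cos x @[x --> (0:R)^'] --> (1 : R).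
Proof. by rewrite -[X in _ --> X]cos0; apply: cvg_within_filter; exact: continuous_cos. Qed.

Lemma cvg_sin_ratio : sin_ratio x @[x --> 0^'] --> (1 : R).
Proof.
apply: is_derive0_slope; first exact: sin0.
by rewrite -[X in is_derive _ _ _ X]cos0; exact: is_derive_sin.
Qed.

Lemma cvg_ell_ratio : ell_ratio x @[x --> 0^'] --> (1 : R).
Proof.
have h0 : - (pi / 2) < (0 : R) < pi / 2 by have := @pihalf_gt0 R; rewrite oppr_lt0 => ->.
have D := der_mul (der_mul (is_derive_cos 0) (is_derive_cos 0)) (is_derive_ell h0).
apply: (@is_derive0_slope (fun x => cos x * cos x * ell x)); first by rewrite ell0 mulr0.
by apply: (der_eq D); rewrite cos0 sin0 ell0; field.
Qed.

(** Bound for the distance from [H n r alpha / x] to its limit, where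
    [x = alpha_bar n alpha]; it does not involve [alpha] otherwise. *)
Definition optimality_error r x : R :=
  `|ell_ratio x - 1| + (2 + r) * `|sin_ratio x - 1|
  + r * pi * `|cos x * sin_ratio x ^+ 2 - 1|.

Lemma cvg_optimality_error r : optimality_error r x @[x --> 0^'] --> (0 : R).
Proof.
have z (f : R -> R) : f x @[x --> 0^'] --> (1 : R) -> `|f x - 1| @[x --> 0^'] --> (0 : R).
  move=> cf; rewrite [X in _ --> X](_ : 0 = `|1 - 1|); last by rewrite subrr normr0.
  by apply: cvg_norm; apply: cvgB => //; exact: cvg_cst.
rewrite [X in _ --> X](_ : 0 = 0 + (2 + r) * 0 + r * pi * 0); last by ring.
apply: cvgD; last first.
  apply: cvgM; first exact: cvg_cst.
  apply: z; rewrite [X in _ --> X](_ : 1 = 1 * (1 * 1)); last by ring.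
  apply: cvgM; first exact: cvg_cos0.
  by apply: cvgM; exact: cvg_sin_ratio.
apply: cvgD; first exact: (z _ cvg_ell_ratio).
by apply: cvgM; [exact: cvg_cst|exact: (z _ cvg_sin_ratio)].
Qed.

Lemma H_ell n r alpha : 0 <= alpha < pi / 2 -> 0 <= alpha_bar n alpha < pi / 2 ->
  H n r alpha =
  sin alpha * cos (alpha_bar n alpha) ^+ 2 * ell (alpha_bar n alpha)
  - cos alpha ^+ 2 * sin (alpha_bar n alpha) * ell alpha
  - r * sin (2 * alpha) * sin (alpha_bar n alpha)
  - r * (n - 2) * cos (alpha_bar n alpha) * sin (alpha_bar n alpha) ^+ 2.
Proof. by move=> h1 h2; rewrite /H !log_tanE. Qed.

(** As [(n - 2) * alpha_bar n alpha = pi - 2 * alpha], the quotient depends on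
    [n] only through ratios that tend to [1], and their coefficients are
    bounded uniformly in [alpha]. *)
Lemma H_optimality n r alpha : 0 <= r -> 2 < n -> 0 <= alpha < pi / 2 ->
  0 < alpha_bar n alpha < pi / 2 ->
  `|H n r alpha / alpha_bar n alpha - optimality r alpha| <=
  optimality_error r (alpha_bar n alpha).
Proof.
move=> r0 n2 aa /andP[x0 xp]; rewrite H_ell ?(ltW x0)//.
have nx : (n - 2) * alpha_bar n alpha = pi - 2 * alpha.
  by rewrite mulrC divfK// gt_eqF// subr_gt0.
move: x0 xp nx; set x := alpha_bar n alpha => x0 xp nx.
have x0' : x != 0 by rewrite gt_eqF.
have [a0 ap] := andP aa.
have c0 := cos_gt0 aa; have s0 := sin_ge0 aa; have l0 := ell_ge0 aa.
rewrite [X in `|X|](_ : _ =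
  sin alpha * (ell_ratio x - 1) - (cos alpha ^+ 2 * ell alpha + r * sin (2 * alpha)) * (sin_ratio x - 1)
  - r * ((n - 2) * x) * (cos x * sin_ratio x ^+ 2 - 1)); last first.
  by rewrite /optimality /area_factor /ell_ratio /sin_ratio -nx; field.
rewrite nx; apply: le_trans (ler_normB _ _) _; apply: lerD.
  apply: le_trans (ler_normB _ _) _; apply: lerD.
    rewrite normrM ger0_norm// ler_piMl// sin_le1//.
  rewrite normrM ler_wpM2r//; apply: le_trans (ler_normD _ _) _; apply: lerD.
    rewrite ger0_norm; last by rewrite mulr_ge0// sqr_ge0.
    apply: le_trans (cos_sqr_ell_le aa) _.
    by have := cos_le1 alpha; lra.
  by rewrite normrM ger0_norm// ler_piMr// sin_max.
rewrite normrM ler_wpM2r// normrM ger0_norm// ler_wpM2l//.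
by rewrite ger0_norm; lra.
Qed.

Lemma cvg_dnbhs0 (u : R -> R) :
  (\forall n \near +oo, 0 < u n <= pi / (n - 2)) -> u n @[n --> +oo] --> (0:R)^'.
Proof.
move=> hu A /nbhs_ballP[e /= e0 hA].
suff : \forall n \near +oo, A (u n) by [].
near=> n.
have : 0 < u n <= pi / (n - 2) by near: n.
move=> /andP[u0 un]; apply: hA => /=; last by rewrite gt_eqF.
rewrite /ball/= sub0r normrN gtr0_norm//; apply: le_lt_trans un _.
have n2 : 2 + pi / e < n by near: n; apply: nbhs_pinfty_gt; exact: num_real.
have pe : 0 < pi / e :> R by rewrite divr_gt0 ?pi_gt0.
have n20 : 0 < n - 2 by lra.
by rewrite ltr_pdivrMr// mulrC -ltr_pdivrMr//; lra.
Unshelve. all: by end_near. Qed.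

Lemma alpha_bar_bounds n alpha : 4 < n -> 0 <= alpha < pi / 2 ->
  [/\ 0 < alpha_bar n alpha, alpha_bar n alpha <= pi / (n - 2) &
     alpha_bar n alpha < pi / 2].
Proof.
move=> n4 /andP[a0 ap]; have n2 : 0 < n - 2 by lra.
have h : alpha_bar n alpha <= pi / (n - 2) by rewrite ler_pM2r ?invr_gt0//; lra.
split => //; first by rewrite divr_gt0//; lra.
apply: le_lt_trans h _; rewrite ltr_pM2l ?pi_gt0// ltf_pV2 ?posrE//; lra.
Qed.

(** At [alpha = pi / n], where [alpha_bar n alpha = alpha], the function
    [H n r] is nonpositive.  At a fixed angle beyond the root of [optimality]
    it is positive for large [n]. *)
Lemma H_root_exists r : 0 <= r -> \forall n \near +oo,
  exists alpha, pi / n <= alpha < pi / 2 /\ H n r alpha = 0.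
Proof.
move=> r0; have [ai /andP[ai0 aip] Pi] := optimality_root r0.
pose y := (ai + pi / 2) / 2.
have yy : 0 <= y < pi / 2 by rewrite /y; apply/andP; split; lra.
have Py : 0 < optimality r y.
  by rewrite -Pi; apply: optimality_lt => //; rewrite /y; lra.
have y0 : 0 < y by have := @pihalf_gt0 R; rewrite /y; lra.
have cy : optimality_error r (alpha_bar n y) @[n --> +oo] --> (0 : R).
  apply: cvg_comp; last exact: cvg_optimality_error.
  apply: cvg_dnbhs0; near=> n.
  have n4 : 4 < n by near: n; apply: nbhs_pinfty_gt; exact: num_real.
  by have [-> ->] := alpha_bar_bounds n4 yy.
near=> n.
have n4 : 4 < n by near: n; apply: nbhs_pinfty_gt; exact: num_real.
have n0 : 0 < n by lra.
have [by0 _ byp] := alpha_bar_bounds n4 yy.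
have Hy : 0 < H n r y.
  have : optimality_error r (alpha_bar n y) < optimality r y.
    by near: n; move/cvgr_lt : cy; apply.
  have n2 : 2 < n by lra.
  have bb : 0 < alpha_bar n y < pi / 2 by rewrite by0.
  have := H_optimality r0 n2 yy bb.
  rewrite ler_norml => /andP[h _] h'.
  have : 0 < H n r y / alpha_bar n y by lra.
  by rewrite pmulr_lgt0// invr_gt0.
have ny : pi / y <= n by near: n; apply: nbhs_pinfty_ge; exact: num_real.
have piny : pi / n <= y.
  by rewrite ler_pdivrMr// mulrC -ler_pdivrMr.
have pin0 : 0 < pi / n by rewrite divr_gt0 ?pi_gt0.
have [_ yp] := andP yy.
have pip : 0 <= pi / n < pi / 2 by rewrite (ltW pin0) (le_lt_trans piny).
have ba : alpha_bar n (pi / n) = pi / n.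
  by rewrite /alpha_bar; field; rewrite gt_eqF//= gt_eqF//; lra.
have Hpin : H n r (pi / n) <= 0.
  rewrite H_ell// ba//; have s0 := sin_ge0 pip; have c0 := cos_gt0 pip.
  have -> : sin (2 * (pi / n)) = 2 * sin (pi / n) * cos (pi / n).
    by rewrite mulr_natl sin_mulr2n mulr2n; ring.
  have nn : 0 <= r * n * cos (pi / n) * sin (pi / n) ^+ 2.
    by rewrite mulr_ge0 ?sqr_ge0// mulr_ge0 ?(ltW c0)// mulr_ge0// ltW.
  by move: nn; lra.
have rng z : pi / n <= z <= y -> 0 <= z < pi / 2.
  by move=> /andP[z1 z2]; rewrite (le_trans (ltW pin0) z1) (le_lt_trans z2).
(* [H n r] with [ell] for [log_tan]: sums and products of continuous functions. *)
pose H' := fun alpha => sin alpha * (cos (alpha_bar n alpha) * cos (alpha_bar n alpha)) * ell (alpha_bar n alpha)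
  - (cos alpha * cos alpha) * sin (alpha_bar n alpha) * ell alpha
  - r * sin (2 * alpha) * sin (alpha_bar n alpha)
  - r * (n - 2) * cos (alpha_bar n alpha) * (sin (alpha_bar n alpha) * sin (alpha_bar n alpha)).
have HE z : pi / n <= z <= y -> H n r z = H' z.
  move=> /rng zz; have [b1 _ b2] := alpha_bar_bounds n4 zz.
  by rewrite H_ell// ?ltW.
have cH z : pi / n <= z <= y -> {for z, continuous H'}.
  move=> /rng zz; have [b1 _ b2] := alpha_bar_bounds n4 zz.
  have Db : {for z, continuous (alpha_bar n)}.
    by apply: cvgM; [apply: cvgB; [exact: cvg_cst|apply: cvgM; [exact: cvg_cst|exact: cvg_id]]|exact: cvg_cst].
  have cl x : - (pi / 2) < x < pi / 2 -> {for x, continuous (@ell R)}.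
    by move=> xx; exact: (is_derive_continuous (is_derive_ell xx)).
  have c1 : {for z, continuous (fun a => cos (alpha_bar n a))}.
    by apply: continuous_comp => //; exact: continuous_cos.
  have c2 : {for z, continuous (fun a => sin (alpha_bar n a))}.
    by apply: continuous_comp => //; exact: continuous_sin.
  have c3 : {for z, continuous (fun a => ell (alpha_bar n a))}.
    apply: continuous_comp => //; apply: cl; rewrite b2 andbT.
    by apply: lt_trans b1; have := @pihalf_gt0 R; lra.
  have c4 : {for z, continuous (@ell R)}.
    by apply: cl; have /andP[z0 ->] := zz; have := @pihalf_gt0 R; lra.
  have c5 : {for z, continuous (fun a : R => sin (2 * a))}.
    apply: (@continuous_comp _ _ _ (fun a : R => 2 * a) sin); last exact: continuous_sin.
    by apply: cvgM; [exact: cvg_cst|exact: cvg_id].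
  have c6 := @continuous_sin R z; have c7 := @continuous_cos R z.
  apply: cvgB; last by do ?[apply: cvgM | exact: cvg_cst | by []].
  apply: cvgB; last by do ?[apply: cvgM | exact: cvg_cst | by []].
  by apply: cvgB; do ?[apply: cvgM | exact: cvg_cst | by []].
have e1 : H' (pi / n) <= 0 by rewrite -HE// lexx.
have e2 : 0 <= H' y by rewrite -HE ?lexx ?piny// ltW.
have [||x] := @IVT R H' (pi / n) y 0 piny.
- apply: continuous_in_subspaceT => z /[!(@mem_setE R)]; rewrite in_itv/= => zz.
  exact: cH.
- by rewrite ge_min e1 le_max e2 orbT.
rewrite in_itv/= => xx Hx; exists x; rewrite HE// Hx; split => //.
by have /andP[-> _] := xx; have /andP[_ ->] := rng _ xx.
Unshelve. all: by end_near. Qed.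
End roots.

(** * The limit of the shape constant *)

Section limit.
Variable R : realType.
Implicit Types x y n r alpha : R.

Lemma alpha_star_spec r : 0 <= r -> \forall n \near +oo,
  [/\ 0 <= alpha_star n r < pi / 2, 0 < alpha_star n r & H n r (alpha_star n r) = 0].
Proof.
move=> r0; near=> n.
have ex : exists alpha, pi / n <= alpha < pi / 2 /\ H n r alpha = 0.
  by near: n; exact: H_root_exists.
have n0 : 0 < n by near: n; apply: nbhs_pinfty_gt; exact: num_real.
have pin0 : 0 < pi / n by rewrite divr_gt0 ?pi_gt0.
have := getPex ex; rewrite -/(alpha_star n r) => -[/andP[a1 a2] a3].
have a0 := lt_le_trans pin0 a1.
by rewrite (ltW a0) a2.
Unshelve. all: by end_near. Qed.

Lemma cvg_alpha_bar_star r : 0 <= r ->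
  alpha_bar n (alpha_star n r) @[n --> +oo] --> (0:R)^'.
Proof.
move=> r0; apply: cvg_dnbhs0; near=> n.
have [aa _ _] : [/\ 0 <= alpha_star n r < pi / 2, 0 < alpha_star n r & H n r (alpha_star n r) = 0].
  by near: n; exact: alpha_star_spec.
have n4 : 4 < n by near: n; apply: nbhs_pinfty_gt; exact: num_real.
by have [-> ->] := alpha_bar_bounds n4 aa.
Unshelve. all: by end_near. Qed.

(** By [H_optimality], [optimality r] tends to [0] along the roots; it is
    strictly increasing and vanishes at [alpha]. *)
Lemma cvg_alpha_star r alpha : 0 <= r -> 0 <= alpha < pi / 2 ->
  optimality r alpha = 0 -> alpha_star n r @[n --> +oo] --> alpha.
Proof.
move=> r0 /andP[a0 ap] Pa.
have ce : optimality_error r (alpha_bar n (alpha_star n r)) @[n --> +oo] --> (0 : R).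
  by apply: cvg_comp (cvg_alpha_bar_star r0) _; exact: cvg_optimality_error.
have spec := alpha_star_spec r0.
have close c : 0 < c -> \forall n \near +oo, `|optimality r (alpha_star n r)| < c.
  move=> c0; near=> n.
  have [aa _ Ha] : [/\ 0 <= alpha_star n r < pi / 2, 0 < alpha_star n r & H n r (alpha_star n r) = 0].
    by near: n.
  have n4 : 4 < n by near: n; apply: nbhs_pinfty_gt; exact: num_real.
  have [b0 _ bp] := alpha_bar_bounds n4 aa.
  have n2 : 2 < n by lra.
  have bb : 0 < alpha_bar n (alpha_star n r) < pi / 2 by rewrite b0.
  have := H_optimality r0 n2 aa bb; rewrite Ha mul0r sub0r normrN => h.
  by apply: le_lt_trans h _; near: n; move/cvgr_lt : ce; apply.
apply/cvgrPdist_lt => e e0.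
(* Barriers on both sides of [alpha]; the lower one may fall below [0]. *)
pose y := alpha + Num.min e (pi / 2 - alpha) / 2.
have m0 : 0 < Num.min e (pi / 2 - alpha) by rewrite lt_min e0 subr_gt0.
have m1 : Num.min e (pi / 2 - alpha) <= e by rewrite ge_min lexx.
have m2 : Num.min e (pi / 2 - alpha) <= pi / 2 - alpha by rewrite ge_min lexx orbT.
have ay : alpha < y by rewrite /y; lra.
have yp : y < pi / 2 by rewrite /y; lra.
have ye : y < alpha + e by rewrite /y; lra.
have Py : 0 < optimality r y by rewrite -Pa; exact: optimality_lt.
have [c [c0 hc]] : exists c, 0 < c /\ forall z, 0 <= z <= alpha - e -> c <= - optimality r z.
  have [ae|ae] := leP 0 (alpha - e).
    exists (- optimality r (alpha - e)); split.
      by rewrite oppr_gt0 -Pa; apply: optimality_lt => //; lra.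
    move=> z /andP[z0]; rewrite le_eqVlt => /predU1P[->//|zl].
    by rewrite lerN2 ltW//; apply: optimality_lt => //; lra.
  by exists 1; split => // z /andP[z0 za]; exfalso; move: z0 za ae; lra.
near=> n.
have [/andP[s0 sp] _ _] : [/\ 0 <= alpha_star n r < pi / 2, 0 < alpha_star n r & H n r (alpha_star n r) = 0].
  by near: n.
have h1 : `|optimality r (alpha_star n r)| < optimality r y by near: n; exact: close.
have h2 : `|optimality r (alpha_star n r)| < c by near: n; exact: close.
have u : alpha_star n r < y.
  rewrite ltNge; apply/negP; rewrite le_eqVlt => /predU1P[ys|ys].
    by move: h1; rewrite -ys; have := ler_norm (optimality r y); lra.
  have y0 : 0 <= y by lra.
  have := optimality_lt r0 y0 ys sp.
  by have := ler_norm (optimality r (alpha_star n r)); lra.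
have l : alpha - e < alpha_star n r.
  rewrite ltNge; apply/negP => h; have := hc (alpha_star n r).
  rewrite s0 h => /(_ isT); have := ler_norm (- optimality r (alpha_star n r)).
  by rewrite normrN; lra.
by rewrite ltr_norml; apply/andP; split; lra.
Unshelve. all: by end_near. Qed.

(** Dividing numerator and denominator of [g n r] by [alpha_bar] leaves ratios
    that tend to [1]. *)
Lemma g_inftyE r alpha : 0 <= r -> 0 <= alpha < pi / 2 -> optimality r alpha = 0 ->
  g_infty r = 3 * Num.sqrt (area_factor alpha) / (2 * (1 + 2 * r * cos alpha)).
Proof.
move=> r0 aa Pa; have c0 := cos_gt0 aa.
have ca := cvg_alpha_star r0 aa Pa.
have cb := cvg_alpha_bar_star r0.
have cs : sin_ratio (alpha_bar n (alpha_star n r)) @[n --> +oo] --> (1 : R).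
  by apply: cvg_comp cb _; exact: cvg_sin_ratio.
have cl : ell_ratio (alpha_bar n (alpha_star n r)) @[n --> +oo] --> (1 : R).
  by apply: cvg_comp cb _; exact: cvg_ell_ratio.
have cc : cos (alpha_bar n (alpha_star n r)) @[n --> +oo] --> (1 : R).
  by apply: cvg_comp cb _; exact: cvg_cos0.
pose G n := 3 * sin_ratio (alpha_bar n (alpha_star n r)) *
  Num.sqrt (sin (2 * alpha_star n r) + (pi - 2 * alpha_star n r) *
    (cos (alpha_bar n (alpha_star n r)) * sin_ratio (alpha_bar n (alpha_star n r)))) /
  (sin_ratio (alpha_bar n (alpha_star n r)) + ell_ratio (alpha_bar n (alpha_star n r))
   + 4 * r * sin_ratio (alpha_bar n (alpha_star n r)) * cos (alpha_star n r)).
have cG : G n @[n --> +oo] -->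
  3 * 1 * Num.sqrt (sin (2 * alpha) + (pi - 2 * alpha) * (1 * 1)) / (1 + 1 + 4 * r * 1 * cos alpha).
  have c2a : 2 * alpha_star n r @[n --> +oo] --> 2 * alpha.
    by apply: cvgM => //; exact: cvg_cst.
  apply: cvgM; last first.
    apply: cvgV; first by rewrite gt_eqF// ltr_wpDr// !mulr_ge0// ltW.
    apply: cvgD; first by apply: cvgD.
    apply: cvgM; last by apply: cvg_comp ca _; exact: continuous_cos.
    by apply: cvgM => //; exact: cvg_cst.
  apply: cvgM; first by apply: cvgM => //; exact: cvg_cst.
  apply: (@cvg_comp _ _ _ _ (@Num.sqrt R)); last exact: sqrt_continuous.
  apply: cvgD; first by apply: cvg_comp c2a _; exact: continuous_sin.
  apply: cvgM; last exact: cvgM.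
  by apply: cvgB => //; exact: cvg_cst.
have cg : g n r @[n --> +oo] --> 3 * Num.sqrt (area_factor alpha) / (2 * (1 + 2 * r * cos alpha)).
  rewrite [X in _ --> X](_ : _ = 3 * 1 * Num.sqrt (sin (2 * alpha) + (pi - 2 * alpha) * (1 * 1)) / (1 + 1 + 4 * r * 1 * cos alpha)); last first.
    by rewrite !mulr1 /area_factor; congr (_ / _); ring.
  apply: cvg_trans cG; apply: near_eq_cvg; near=> n.
  have [an _ _] : [/\ 0 <= alpha_star n r < pi / 2, 0 < alpha_star n r & H n r (alpha_star n r) = 0].
    by near: n; exact: alpha_star_spec.
  have n4 : 4 < n by near: n; apply: nbhs_pinfty_gt; exact: num_real.
  have [b0 _ bp] := alpha_bar_bounds n4 an.
  have nx : (n - 2) * alpha_bar n (alpha_star n r) = pi - 2 * alpha_star n r.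
    by rewrite mulrC divfK// gt_eqF// subr_gt0; lra.
  rewrite /G /g/= log_tanE ?(ltW b0)// -nx /sin_ratio /ell_ratio.
  set x := alpha_bar n (alpha_star n r) in b0 bp nx *.
  have x0' : x != 0 by rewrite gt_eqF.
  have -> : (n - 2) * x * (cos x * (sin x / x)) = (n - 2) * cos x * sin x by field.
  set A := Num.sqrt _.
  have bb : 0 <= x < pi / 2 by rewrite ltW.
  have bb' : 0 < x < pi by rewrite b0/=; have := @pi_gt0 R; lra.
  have sx : 0 < sin x by exact: sin_gt0_pi.
  have lx := ell_ge0 bb; have cx := cos_gt0 an.
  have den : 0 < sin x + cos x ^+ 2 * ell x + 4 * r * sin x * cos (alpha_star n r).
    have t1 : 0 <= cos x ^+ 2 * ell x by rewrite mulr_ge0// sqr_ge0.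
    have t2 : 0 <= 4 * r * sin x * cos (alpha_star n r).
      by rewrite mulr_ge0 ?(ltW cx)// mulr_ge0 ?(ltW sx)// mulr_ge0.
    lra.
  have den' : sin x + cos x ^+ 2 * ell x + 4 * r * sin x * cos (alpha_star n r) != 0 by rewrite gt_eqF.
  have -> : sin x / x + cos x ^+ 2 * ell x / x + 4 * r * (sin x / x) * cos (alpha_star n r)
    = (sin x + cos x ^+ 2 * ell x + 4 * r * sin x * cos (alpha_star n r)) / x by field.
  by field; rewrite den' x0'.
exact: (cvg_lim _ cg).
Unshelve. all: by end_near. Qed.
End limit.

(** * Closed forms at the optimal angle *)

Section closed_forms.
Variable R : realType.
Implicit Types (rho alpha r : R).

Lemma half_chord_cos rho alpha : 0 < rho -> 0 <= alpha < pi / 2 ->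
  half_chord rho (rho * cos alpha) = rho * sin alpha.
Proof.
move=> rho0 aa; rewrite /half_chord.
have -> : rho ^+ 2 - (rho * cos alpha) ^+ 2 = (rho * sin alpha) ^+ 2.
  by rewrite !exprMn sin2cos2; ring.
by rewrite sqrtr_sqr ger0_norm// mulr_ge0 ?(ltW rho0)// sin_ge0.
Qed.

Lemma chord_value_cos rho alpha : 0 < rho -> 0 <= alpha < pi / 2 ->
  chord_value rho (rho * cos alpha) =
  rho ^+ 2 * (sin alpha - cos alpha ^+ 2 * ell alpha).
Proof.
move=> rho0 aa; rewrite /chord_value half_chord_cos// /ell.
have c0 := cos_gt0 aa; have s0 := sin_ge0 aa.
have -> : rho + rho * sin alpha = rho * (1 + sin alpha) by ring.
have s1 : 0 < 1 + sin alpha by lra.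
by rewrite !lnM ?posrE//; ring.
Qed.

(** Here [cos alpha / (1 + sin alpha)] is the tangent of
    [pi / 4 - alpha / 2]. *)
Lemma chord_primitive_cos rho alpha : 0 < rho -> 0 <= alpha < pi / 2 ->
  chord_primitive rho (rho * cos alpha) =
  rho ^+ 3 * (cos alpha * sin alpha + (pi / 2 - alpha) +
    cos alpha * (sin alpha - cos alpha ^+ 2 * ell alpha)) / 3.
Proof.
move=> rho0 aa; rewrite /chord_primitive chord_value_cos// half_chord_cos//.
have /andP[a0 ap] := aa; have c0 := cos_gt0 aa; have s0 := sin_ge0 aa.
pose y := pi / 4 - alpha / 2.
have pi0 := @pi_gt0 R.
have yy : 0 <= y < pi / 2 by rewrite /y; apply/andP; split; lra.
have cy := cos_gt0 yy.
have ey : y *+ 2 = pi / 2 - alpha by rewrite /y mulr2n; lra.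
have e1 : cos alpha = 2 * sin y * cos y.
  have -> : alpha = pi / 2 - y *+ 2 by rewrite ey; lra.
  by rewrite addrC cosDpihalf sinN opprK sin_mulr2n mulr2n; ring.
have e2 : 1 + sin alpha = 2 * cos y ^+ 2.
  have -> : alpha = pi / 2 - y *+ 2 by rewrite ey; lra.
  by rewrite [pi / 2 - _]addrC sinDpihalf cosN cos_mulr2n mulr2n; ring.
have -> : rho * cos alpha / (rho + rho * sin alpha) = tan y.
  have -> : rho + rho * sin alpha = rho * (1 + sin alpha) by ring.
  by rewrite e2 {1}e1 /tan; field; rewrite gt_eqF// gt_eqF.
rewrite tanK; last by rewrite in_itv/=; have /andP[] := yy => y1 y2; rewrite y2 andbT; lra.
by rewrite /y; field.
Qed.

(** Twice this quantity is the constant term in the bound for the gain of a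
    leg. *)
Lemma optimal_gain rho alpha r : 0 < rho -> 0 <= alpha < pi / 2 ->
  optimality r alpha = 0 ->
  chord_primitive rho (rho * cos alpha) -
    chord_value rho (rho * cos alpha) * (rho * cos alpha) =
  rho ^+ 3 * area_factor alpha * (1 - 4 * r * cos alpha) / 6.
Proof.
move=> rho0 aa Pa; rewrite chord_primitive_cos// chord_value_cos//.
have -> : sin alpha - cos alpha ^+ 2 * ell alpha = r * area_factor alpha.
  by apply/eqP; rewrite -subr_eq0; apply/eqP.
have -> : cos alpha * sin alpha + (pi / 2 - alpha) = area_factor alpha / 2.
  by rewrite /area_factor mulr_natl sin_mulr2n mulr2n; field.
by field.
Qed.

End closed_forms.

(** * Lower bound for the cost *)

Section tour.
Variable R : realType.

(** A cone exceeds the preceding one by at most the positive part of their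
    difference. *)
Lemma telescoped_cone (rho : R) (y : nat -> R * R) (n j : nat) (x : R * R) :
  (j <= n)%N ->
  cone rho (x - y j) <= cone rho (x - y 0%N) +
    \sum_(i < n) Num.max 0 (cone rho (x - y i.+1) - cone rho (x - y i)).
Proof.
move=> jn; apply: (@le_trans _ _ (cone rho (x - y 0%N) +
    \sum_(i < j) Num.max 0 (cone rho (x - y i.+1) - cone rho (x - y i)))).
  elim: j {jn} => [|j IH]; first by rewrite big_ord0 addr0.
  rewrite big_ord_recr/= addrA.
  have := lerD IH (lexx (Num.max 0 (cone rho (x - y j.+1) - cone rho (x - y j)))).
  apply: le_trans; rewrite -lerBlDl le_max lexx orbT//.
rewrite lerD2l -(big_mkord xpredT (fun i => Num.max 0 (cone rho (x - y i.+1) - cone rho (x - y i)))).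
rewrite -(big_mkord xpredT (fun i => Num.max 0 (cone rho (x - y i.+1) - cone rho (x - y i)))).
rewrite [leRHS](big_cat_nat (leq0n j) jn)/= lerDl sumr_ge0// => i _.
by rewrite le_max lexx.
Qed.

Lemma euclid_distC (p q : R * R) : euclid_dist p q = euclid_dist q p.
Proof. by rewrite /euclid_dist /enorm /=; congr Num.sqrt; ring. Qed.

Lemma sum_truck_distance (D : design R) (N : nat) :
  \sum_(i < N) truck_distance D i =
  \sum_(i < N) euclid_dist (tour D i) (tour D (ordS i)).
Proof.
rewrite /truck_distance -mulr_sumr big_split/=.
have -> : \sum_(i < N) euclid_dist (tour D i) (tour D (ord_pred i)) =
    \sum_(i < N) euclid_dist (tour D i) (tour D (ordS i)).
  rewrite (reindex_inj (can_inj (@ordSK N)))/=; apply: eq_bigr => i _.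
  by rewrite ordSK euclid_distC.
by field.
Qed.
End tour.

Lemma integral_add_sum_le d (T : measurableType d) (R : realType)
    (mu : {measure set T -> \bar R}) (n : nat) (f0 : T -> R) (f : 'I_n -> T -> R)
    (c0 : R) (c : 'I_n -> R) :
  measurable_fun setT f0 -> (forall x, 0 <= f0 x) ->
  (forall i, measurable_fun setT (f i)) -> (forall i x, 0 <= f i x) ->
  (\int[mu]_x (f0 x)%:E <= c0%:E)%E ->
  (forall i, \int[mu]_x (f i x)%:E <= (c i)%:E)%E ->
  (\int[mu]_x (f0 x + \sum_(i < n) f i x)%:E <= (c0 + \sum_(i < n) c i)%:E)%E.
Proof.
move=> mf0 f00 mf f0' h0 h.
have mf0E : measurable_fun setT (EFin \o f0) by exact/measurable_EFinP.
have mfE i : measurable_fun setT (EFin \o f i) by exact/measurable_EFinP.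
have e : (\int[mu]_x (f0 x + \sum_(i < n) f i x)%:E =
    \int[mu]_x ((f0 x)%:E + \sum_(i < n) (f i x)%:E))%E.
  by apply: eq_integral => x _; rewrite EFinD sumEFin.
have f00E x : setT x -> (0 <= (f0 x)%:E)%E by rewrite lee_fin.
have sE : measurable_fun setT (fun x => \sum_(i < n) (f i x)%:E)%E.
  exact: emeasurable_sum.
have s0E x : setT x -> (0 <= \sum_(i < n) (f i x)%:E)%E.
  by move=> _; apply: sume_ge0 => i _; rewrite lee_fin.
rewrite e (ge0_integralD mu measurableT f00E mf0E s0E sE).
rewrite ge0_integral_sum//; last by move=> i x _; rewrite lee_fin.
by rewrite EFinD -sumEFin; apply: leeD => //; apply: lee_sum.
Qed.

Section allocation.
Variable R : realType.
Notation P := (measurableTypeR R * measurableTypeR R)%type.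

(** The function dominating all the cones is the cone over the first stop plus
    the gains of the [n] legs that follow; the leg that closes the tour only
    increases the right-hand side. *)
Lemma allocation_bound (D : design R) (n : nat) (rho a : R) :
  0 < rho -> 0 < a <= rho ->
  ((rho * \sum_(i < n.+1) fine (area (region D (tour D i))))%:E <=
  \sum_(i < n.+1) \int[@area R]_(x in region D (tour D i)) (euclid_dist x (tour D i))%:E
  + (chord_value rho a * \sum_(i < n.+1) truck_distance D i
     + n.+1%:R * (2 * (chord_primitive rho a - chord_value rho a * a)) + 2 * chord_value rho a * rho)%:E)%E.
Proof.
move=> rho0 aa; set gain := chord_primitive rho a - _.
have K0 := chord_value_ge0 rho0 aa.
pose y (k : nat) := tour D (inord k : 'I_n.+1).
pose gains (i : 'I_n) (x : R * R) :=
  Num.max 0 (cone rho (x - y i.+1) - cone rho (x - y i)).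
pose G (x : R * R) := cone rho (x - y 0%N) + \sum_(i < n) gains i x.
have mc (p : R * R) := measurable_cone_shift rho p.
have mg (i : 'I_n) : measurable_fun setT (gains i : P -> R).
  by apply: measurable_maxr => //; exact: measurable_funB.
have g0 (i : 'I_n) x : 0 <= gains i x by rewrite le_max lexx.
have G0 x : 0 <= G x.
  by rewrite addr_ge0 ?cone_ge0// sumr_ge0.
have mG : measurable_fun setT (G : P -> R).
  apply: measurable_funD; first exact: mc.
  exact: measurable_sum.
have hG (i : 'I_n.+1) x : rho <= euclid_dist x (tour D i) + G x.
  have : cone rho (x - y i) <= G x := @telescoped_cone R rho y n i x (ltn_ord i).
  have -> : y i = tour D i by rewrite /y inord_val.
  have : rho - euclid_dist x (tour D i) <= cone rho (x - tour D i).
    by rewrite le_max lexx orbT.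
  lra.
have := covering_integral_bound (ltW rho0) mG G0 hG.
move=> /le_trans; apply; apply: leeD => //.
have hc : (\int[@borel_area R]_x (cone rho (x - y 0%N))%:E <=
    (2 * (chord_value rho a * rho + gain))%:E)%E.
  have mcE : measurable_fun setT (EFin \o cone rho : P -> _).
    by apply/measurable_EFinP; exact: measurable_cone.
  have c0 x : (0 <= (EFin \o cone rho) x)%E by rewrite lee_fin cone_ge0.
  have -> := integral_translation2 (y 0%N) mcE c0.
  exact: integral_cone.
have hg (i : 'I_n) : (\int[@borel_area R]_x (gains i x)%:E <=
    (chord_value rho a * euclid_dist (y i) (y i.+1) + 2 * gain)%:E)%E.
  exact: integral_cone_gain.
have := @integral_add_sum_le _ P R (@borel_area R) n _ gains _ _ (mc (y 0%N))
  (fun x => cone_ge0 rho _) mg g0 hc hg.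
move=> /le_trans; apply; rewrite lee_fin.
rewrite big_split/= -mulr_sumr sumr_const card_ord.
have hT : \sum_(i < n) euclid_dist (y i) (y i.+1) <= \sum_(i < n.+1) truck_distance D i.
  rewrite sum_truck_distance big_ord_recr/=.
  rewrite -[leLHS]addr0; apply: lerD; last exact: sqrtr_ge0.
  apply: ler_sum => i _; rewrite /y.
  have -> : inord i = widen_ord (leqnSn n) i :> 'I_n.+1.
    by apply: val_inj; rewrite /= inordK// ltnW// ltnS.
  have -> : inord i.+1 = ordS (widen_ord (leqnSn n) i) :> 'I_n.+1.
    by apply: val_inj; rewrite /= inordK ?ltnS// modn_small// ltnS.
  by [].
have := ler_wpM2l K0 hT.
by rewrite -mulr_natl -natr1; lra.
Qed.

Lemma amgm3 (p q : R) : 0 <= p -> 0 <= q ->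
  3 * (p * q ^+ 2) `^ 3^-1 <= p + 2 * q.
Proof.
move=> p0 q0.
have pq0 : 0 <= p * q ^+ 2 by rewrite mulr_ge0// sqr_ge0.
set t := _ `^ _.
have t0 : 0 <= t by exact: powR_ge0.
have t3 : t ^+ 3 = p * q ^+ 2.
  by rewrite /t -powR_mulrn ?powR_ge0// -powRrM mulVf// powRr1.
rewrite -(@ler_pXn2r _ 3)// ?nnegrE ?addr_ge0 ?mulr_ge0//.
rewrite exprMn t3 -subr_ge0.
have -> : (p + 2 * q) ^+ 3 - 3 ^+ 3 * (p * q ^+ 2) = (p - q) ^+ 2 * (p + 8 * q) by ring.
by rewrite mulr_ge0 ?sqr_ge0 ?addr_ge0 ?mulr_ge0.
Qed.
End allocation.

Section cost_bound.
Variable R : realType.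

Lemma le_limn_einf (u : (\bar R)^nat) (b : R^nat) (l : R) :
  (\forall n \near \oo, ((b n)%:E <= u n)%E) -> b @ \oo --> l ->
  (l%:E <= limn_einf u)%E.
Proof.
move=> bu bl.
have cb : einfs (EFin \o b) @ \oo --> l%:E by apply: cvg_einfs; apply: cvg_EFin => //; exact: nearW.
rewrite limn_einf_lim -(cvg_lim _ cb)//.
apply: lee_lim; [by apply/cvg_ex; exists l%:E|exact: is_cvg_einfs|].
case: bu => N _ hN; exists N => // n /= Nn.
apply: le_ereal_inf_tmp => _ [k /= nk <-].
apply: le_trans (hN k _); last exact: leq_trans nk.
by apply: ereal_inf_lbound; exists k.
Qed.

Lemma area_factor_gt0 (alpha : R) : 0 <= alpha < pi / 2 -> 0 < area_factor alpha.
Proof.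
move=> aa; have /andP[a0 ap] := aa; have c0 := cos_gt0 aa; have s0 := sin_ge0 aa.
have -> : area_factor alpha = 2 * (sin alpha * cos alpha) + (pi - 2 * alpha).
  by rewrite /area_factor mulr_natl sin_mulr2n mulr2n; ring.
have := mulr_ge0 s0 (ltW c0); lra.
Qed.

(** The radius [rho] is the one for which the truncated disc of half-angle
    [alpha] has the mean area of the regions.  The slope [chord_value] is then
    [r] times this mean area, and the two travel terms cancel. *)
Lemma average_cost_ge (f kappa r alpha : R) (D : design R) (n : nat) :
  0 < f -> 0 < kappa -> 0 <= r ->
  0 <= alpha < pi / 2 -> optimality r alpha = 0 ->
  exists2 rho : R, 0 < rho &
  ((f / (area_factor alpha * rho ^+ 2) +
    kappa * f * rho * (2 / 3 * (1 + 2 * r * cos alpha) - 2 * r / n.+1%:R))%:E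
    <= average_cost f kappa r D n.+1)%E.
Proof.
move=> f0 k0 r0 aa Pa.
have S0 := area_factor_gt0 aa; have c0 := cos_gt0 aa.
set S := area_factor alpha in S0 *; set c := cos alpha in c0 *.
set A := \sum_(i < n.+1) fine (area (region D (tour D i))).
have A0 : 0 < A.
  rewrite /A big_ord_recl; apply: ltr_pwDl.
    by apply: fine_gt0; exact: region_area (tour_facilities D ord0).
  by apply: sumr_ge0 => i _; rewrite fine_ge0// ltW//; have /andP[] := region_area (tour_facilities D (lift ord0 i)).
have N0 : 0 < n.+1%:R :> R by rewrite ltr0n.
pose rho := Num.sqrt (A / (n.+1%:R * S)).
have rho0 : 0 < rho by rewrite sqrtr_gt0 divr_gt0// mulr_gt0.
have rho2 : A = n.+1%:R * S * rho ^+ 2.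
  by rewrite /rho sqr_sqrtr ?divr_ge0 ?mulr_ge0 ?ltW// mulrC divfK// mulf_neq0 ?gt_eqF.
exists rho => //.
have ar : 0 < rho * c <= rho.
  by rewrite mulr_gt0//= ler_piMr ?(ltW rho0)//; exact: cos_le1.
have := @allocation_bound R D n rho (rho * c) rho0 ar.
rewrite -/A (@optimal_gain R rho alpha r)// -/S -/c.
have -> : chord_value rho (rho * c) = rho ^+ 2 * (r * S).
  rewrite chord_value_cos//; congr (_ * _).
  by apply/eqP; rewrite -subr_eq0; apply/eqP.
rewrite /average_cost -/A.
set T := \sum_(i < n.+1) truck_distance D i.
set J := (\sum_(i < n.+1) \int[@area R]_(x in region D (tour D i)) (euclid_dist x (tour D i))%:E)%E.
have -> : (\sum_(i < n.+1) (1 + kappa%:E * \int[@area R]_(x in region D (tour D i)) (euclid_dist x (tour D i))%:E) = n.+1%:R%:E + kappa%:E * J)%E.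
  rewrite big_split/= /J ge0_sume_distrr; last first.
    by move=> i _; apply: integral_ge0 => x _; rewrite lee_fin sqrtr_ge0.
  congr (_ + _)%E.
  by rewrite sumEFin sumr_const card_ord.
have J0 : (0 <= J)%E.
  apply: sume_ge0 => i _; apply: integral_ge0 => x _; rewrite lee_fin; exact: sqrtr_ge0.
(* An infinite access cost makes the average cost infinite. *)
case: J J0 => [j| |] //; last first.
  move=> _ _; rewrite gt0_muley ?lte_fin//.
  by rewrite addey// gt0_muley ?lte_fin ?divr_gt0// addye// leey.
rewrite -EFinM -!EFinD !lee_fin => _ h.
have fA : 0 < f / A by rewrite divr_gt0.
have := ler_wpM2l (ltW (mulr_gt0 fA k0)) h.
have Ai : A != 0 by rewrite gt_eqF.
have Ni : n.+1%:R != 0 :> R by rewrite gt_eqF.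
have Si : S != 0 by rewrite gt_eqF.
have ri : rho != 0 by rewrite gt_eqF.
move=> h'.
rewrite -subr_ge0; move: h'; rewrite -subr_ge0.
congr (0 <= _); rewrite rho2; move: Ni; move: (n.+1%:R : R) => N Ni.
by field; rewrite Si ri Ni.
Qed.

(** The term [2 * r / N] that the first cone contributes vanishes in the
    limit. *)
Lemma cost_ge (f kappa r alpha : R) (D : design R) :
  0 < f -> 0 < kappa -> 0 <= r ->
  0 <= alpha < pi / 2 -> optimality r alpha = 0 ->
  ((3 * (kappa ^+ 2 * f ^+ 3 * (2 / 3 * (1 + 2 * r * cos alpha)) ^+ 2 / (4 * area_factor alpha)) `^ 3^-1)%:E
    <= cost f kappa r D)%E.
Proof.
move=> f0 k0 r0 aa Pa.
have S0 := area_factor_gt0 aa; have c0 := cos_gt0 aa.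
set S := area_factor alpha in S0 *; set c := cos alpha in c0 *.
pose theta : R := 2 / 3 * (1 + 2 * r * c).
have theta0 : 0 < theta.
  by rewrite mulr_gt0// ltr_wpDr// mulr_ge0 ?(ltW c0)// mulr_ge0.
pose thetaN (n : nat) : R := theta - 2 * r / n%:R.
have ctheta : thetaN @ \oo --> theta.
  rewrite -[X in _ --> X]subr0; apply: cvgB; first exact: cvg_cst.
  rewrite -[X in _ --> X](mulr0 (2 * r)); apply: cvgM; first exact: cvg_cst.
  apply/gtr0_cvgV0; last exact: cvgr_idn.
  by exists 1%N => // n /= n0; rewrite ltr0n.
pose w (t : R) := 3 * (kappa ^+ 2 * f ^+ 3 * t ^+ 2 / (4 * S)) `^ 3^-1.
rewrite -/(w theta).
apply: (@le_limn_einf _ (w \o thetaN)); last first.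
  apply: cvgM; first exact: cvg_cst.
  have ct2 : kappa ^+ 2 * f ^+ 3 * thetaN n ^+ 2 / (4 * S) @[n --> \oo] --> kappa ^+ 2 * f ^+ 3 * theta ^+ 2 / (4 * S).
    apply: cvgM; last exact: cvg_cst.
    apply: cvgM; first exact: cvg_cst.
    by rewrite expr2; under eq_fun do rewrite expr2; apply: cvgM.
  apply: (@cvg_comp _ _ _ _ (fun x => x `^ 3^-1) _ _ _ ct2).
  have z0 : 0 < kappa ^+ 2 * f ^+ 3 * theta ^+ 2 / (4 * S).
    apply: divr_gt0; last by rewrite mulr_gt0.
    by apply: mulr_gt0; [apply: mulr_gt0|]; exact: exprn_gt0.
  exact: (is_derive_continuous (is_derive1_powR _ z0)).
near=> n.
have n0 : (0 < n)%N by near: n; exists 1%N.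
have tn : 0 < thetaN n by near: n; move/cvgr_gt : ctheta; apply.
have [rho rho0] := average_cost_ge D n.-1 f0 k0 r0 aa Pa.
rewrite prednK// -/S -/c -/theta -/(thetaN n).
apply: le_trans; rewrite lee_fin.
have p0 : 0 <= f / (S * rho ^+ 2) by rewrite divr_ge0// ?mulr_ge0 ?sqr_ge0 ?ltW.
have q0 : 0 <= kappa * f * rho * thetaN n / 2.
  by rewrite divr_ge0// !mulr_ge0// ltW.
(* The product [p * q ^+ 2] does not depend on [rho]. *)
have := amgm3 p0 q0; rewrite [2 * (_ / 2)]mulrC divfK//.
congr (_ * _ `^ _ <= _).
by field; rewrite !gt_eqF.
Unshelve. all: by end_near. Qed.

End cost_bound.

Local Close Scope classical_set_scope.
Unset Implicit Arguments.

Theorem proposition3 (R : realType) (f kappa r : R)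
    (hf : 0 < f) (hkappa : 0 < kappa) (hr : 0 <= r) :
  let alpha_inf := alpha_star_infty r in
  let g_inf := g_infty r in
  ((3 * (kappa ^+ 2 * f ^+ 3 / (4 * g_inf ^+ 2)) `^ (3^-1))%:E
     <= optimal_value f kappa r)%E.
Proof.
cbv zeta; have [alpha aa Pa] := optimality_root hr.
have S0 := area_factor_gt0 aa; have c0 := cos_gt0 aa.
apply: le_ereal_inf_tmp => _ [D _ <-].
have := cost_ge D hf hkappa hr aa Pa.
congr (_ <= _)%E; congr ((_ * _ `^ _)%:E).
rewrite (g_inftyE hr aa Pa).
have d0 : 1 + 2 * r * cos alpha != 0.
  by rewrite gt_eqF// ltr_wpDr// !mulr_ge0// ltW.
have q0 : 0 < Num.sqrt (area_factor alpha) by rewrite sqrtr_gt0.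
have q2 : area_factor alpha = Num.sqrt (area_factor alpha) ^+ 2 by rewrite sqr_sqrtr ?ltW.
move: q0 q2; set q := Num.sqrt _ => q0 ->.
by field; rewrite d0 gt_eqF.
Qed.
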